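(* Let $k$ be a field, $I$ an ideal of $k[y_1,\ldots,y_m,x_1,\ldots,x_n]$, $J=I\cap k[y_1,\ldots,y_m]$, $B=k[y_1,\ldots,y_m,x_1,\ldots,x_n]/I$ and $A=k[y_1,\ldots,y_m]/J$. Then the largest open subset of $\operatorname{Spec}A$ over which the morphism $\operatorname{Spec}B\to\operatorname{Spec}A$ is finite flat is the complement of $$W\cup V(F),$$ where $W\subseteq\operatorname{Spec}A$ is the non-finite locus and $F$ is the flatness ideal, both defined in the context.
   Context: Write $\boldsymbol{y}=(y_1,\ldots,y_m)$, $\boldsymbol{x}=(x_1,\ldots,x_n)$. $T_x,T_y$ are monomial orders in $\boldsymbol{x}$ and $\boldsymbol{y}$; $\mathcal{G}$ is a Gröbner basis of $I$ for the block order $T_x>T_y$; $\mathcal{G}_x=\mathcal{G}\setminus k[\boldsymbol{y}]$. $\mathtt{LM}_{T_x}(g)$, $\mathtt{LC}_{T_x}(g)\in k[\boldsymbol{y}]$ are the $T_x$-leading monomial and its coefficient for $g$ viewed as a polynomial in $\boldsymbol{x}$ over $k[\boldsymbol{y}]$. Non-finite locus: $J_i=\{\mathtt{LC}_{x_i}(f)\mid f\in I\cap k[\boldsymbol{y},x_i]\}$ (leading coefficient in $x_i$ over $k[\boldsymbol{y}]$, with $\mathtt{LC}_{x_i}(0)=0$), an ideal of $k[\boldsymbol{y}]$ containing $J$, and $W=\bigcup_{i=1}^nV(J_i)\subseteq\operatorname{Spec}A$; it is the smallest closed subset over whose complement $\operatorname{Spec}B\to\operatorname{Spec}A$ is finite.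 The module $B'$: let $\mathcal{P}_i=\{g\in\mathcal{G}_x\mid\mathtt{LM}_{T_x}(g)=x_i^{d(g)}\text{ for some }d(g)>0\}$. If some $\mathcal{P}_i$ is empty, the finite locus is empty ($W=\operatorname{Spec}A$) and $F$ is not defined; $V(F)$ is then read as empty. Otherwise let $t_i=\max\{d(g)\mid g\in\mathcal{P}_i\}$, $\mathcal{M}=\{\prod_{i=1}^nx_i^{a_i}\mid 0\le a_i\le t_i-1\}=\{\mathfrak{m}_1,\ldots,\mathfrak{m}_r\}$, and let $B'\subseteq B$ be the $A$-submodule generated by the residue classes of the $\mathfrak{m}_j$. The matrix $N$: introduce new variables $t,u_1,\ldots,u_r$ and let $\mathcal{L}=I+\langle u_j-t\mathfrak{m}_j\mid j=1,\ldots,r\rangle\subseteq k[\boldsymbol{y},\boldsymbol{x},t,\boldsymbol{u}]$, which is homogeneous in $(t,\boldsymbol{u})$. Let $\mathcal{H}$ be a Gröbner basis of $\mathcal{L}$, consisting of polynomials homogeneous in $(t,\boldsymbol{u})$, for a block order $[\boldsymbol{x},t]>[\boldsymbol{u}]>[\boldsymbol{y}]$ whose order in $\boldsymbol{u}$ is degree-compatible, and let $\{h_1,\ldots,h_s\}=\{h\in\mathcal{H}\cap k[\boldsymbol{y},\boldsymbol{u}]\mid\deg_{\boldsymbol{u}}(h)=1\}$. Write $h_j=\sum_{i=1}^rn_{ij}(\boldsymbol{y})u_i$ and $N=(n_{ij})$, an $r\times s$ matrix; over $A$ it gives a presentation $A^s\xrightarrow{N}A^r\to B'\to0$. The flatness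 ideal: for $i=-1,0,\ldots,r$ put $F_i=J+\langle\mathtt{minors}(N,r-i)\rangle$, where $\mathtt{minors}(N,j)$ is the set of $j\times j$ minors of $N$ (nonexistent minors contribute nothing, so $F_{-1}=J$; the unique $0\times0$ minor is $1$). Then $F=\sum_{i=0}^r\bigl((J:F_{i-1})\cap F_i\bigr)\subseteq k[\boldsymbol{y}]$. *)

(* Defs.v *)
From HB Require Import structures.
From mathcomp Require Import all_boot all_order all_algebra generic_quotient.
From mathcomp Require Import boolp classical_sets.
From mathcomp Require Import mpoly.

Set Implicit Arguments.
Unset Strict Implicit.
Unset Printing Implicit Defensive.

Import GRing.Theory.
Local Open Scope ring_scope.
Local Open Scope classical_set_scope.
Local Open Scope quotient_scope.

(** * Ideals, quotient rings, localisations at an element *)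

(* Unlike MathComp's [idealr], ideals may be improper and need not be given by
   a boolean predicate. *)
Record ideal (R : comPzRingType) := Ideal {
  ideal_set : set R;
  ideal0 : ideal_set 0;
  idealD : forall x y, ideal_set x -> ideal_set y -> ideal_set (x + y);
  idealM : forall a x, ideal_set x -> ideal_set (a * x) }.

Definition ideal_fun (R : comPzRingType) (I : ideal R) : R -> Prop := ideal_set I.
Coercion ideal_fun : ideal >-> Funclass.
Coercion ideal_set : ideal >-> set.

Section IdealTheory.
Variables (R : comPzRingType) (I : ideal R).

Lemma idealN x : I x -> I (- x).
Proof. by rewrite -mulN1r; apply: idealM. Qed.

Lemma idealB x y : I x -> I y -> I (x - y).
Proof. by move=> Ix Iy; apply: idealD => //; apply: idealN. Qed.

End IdealTheory.

Section IdealConstructions.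
Variables R S : comPzRingType.

Section Span.
Variable X : set R.
Definition span_set : set R := [set a | forall K : ideal R, X `<=` K -> K a].
Let span0 : span_set 0. Proof. by move=> K _; apply: (ideal0 K). Qed.
Let spanD x y : span_set x -> span_set y -> span_set (x + y).
Proof. by move=> hx hy K XK; apply: (idealD (i := K)); [apply: hx | apply: hy]. Qed.
Let spanM a x : span_set x -> span_set (a * x).
Proof. by move=> hx K XK; apply: (idealM (i := K)); apply: hx. Qed.
Definition ideal_span : ideal R := Ideal span0 spanD spanM.
End Span.

Section Preimage.
Variables (f : {rmorphism R -> S}) (I : ideal S).
Let preim0 : (f @^-1` I) 0. Proof. by rewrite /preimage /= rmorph0; apply: ideal0. Qed.
Let preimD x y : (f @^-1` I) x -> (f @^-1` I) y -> (f @^-1` I) (x + y).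
Proof. by rewrite /preimage /= rmorphD; apply: idealD. Qed.
Let preimM a x : (f @^-1` I) x -> (f @^-1` I) (a * x).
Proof. by rewrite /preimage /= rmorphM; apply: idealM. Qed.
Definition ideal_preim : ideal R := Ideal preim0 preimD preimM.
End Preimage.

Definition colon (J K : set R) : set R := [set a | forall b, K b -> J (a * b)].

End IdealConstructions.

Section Quotient.
Variables (R : comPzRingType) (I : ideal R).

Definition quot_equiv (x y : R) : bool := `[< I (x - y) >].

Lemma quot_equiv_is_equiv : equiv_class_of quot_equiv.
Proof.
split=> [x|x y|y x z].
- by apply/asboolP; rewrite subrr; apply: ideal0.
- by apply/asboolP/asboolP => /idealN; rewrite opprB.
move=> /asboolP xy /asboolP yz; apply/asboolP.
by rewrite -(subrKA y); apply: idealD.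
Qed.

Canonical quot_equiv_equiv := EquivRelPack quot_equiv_is_equiv.

Definition quot := {eq_quot quot_equiv}.
HB.instance Definition _ := Choice.on quot.
HB.instance Definition _ : EqQuotient R quot_equiv quot := EqQuotient.on quot.

Definition quot_pi (x : R) : quot := \pi_quot x.

Lemma quot_piP x y : reflect (I (x - y)) (quot_pi x == quot_pi y).
Proof. by apply: (iffP eqP) => [/eqquotP/asboolP|h] //; apply/eqquotP/asboolP. Qed.

Lemma quot_piK (q : quot) : quot_pi (repr q) = q.
Proof. exact: reprK. Qed.

Lemma repr_quot_pi x : I (x - repr (quot_pi x)).
Proof. by apply/quot_piP; rewrite quot_piK. Qed.

Lemma quotW (P : quot -> Prop) : (forall x, P (quot_pi x)) -> forall q, P q.
Proof. by move=> h q; rewrite -(quot_piK q). Qed.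

Definition quot_add (p q : quot) := quot_pi (repr p + repr q).
Definition quot_opp (p : quot) := quot_pi (- repr p).
Definition quot_mul (p q : quot) := quot_pi (repr p * repr q).

Lemma quot_addE x y : quot_add (quot_pi x) (quot_pi y) = quot_pi (x + y).
Proof.
apply/esym/eqP/quot_piP; rewrite opprD addrACA.
by apply: idealD; apply: repr_quot_pi.
Qed.

Lemma quot_oppE x : quot_opp (quot_pi x) = quot_pi (- x).
Proof. by apply/esym/eqP/quot_piP; rewrite -opprD; apply/idealN/repr_quot_pi. Qed.

Lemma quot_mulE x y : quot_mul (quot_pi x) (quot_pi y) = quot_pi (x * y).
Proof.
apply/esym/eqP/quot_piP; set x' := repr _; set y' := repr _.
have -> : x * y - x' * y' = y * (x - x') + x' * (y - y').
  by rewrite !mulrBr (mulrC y x) (mulrC y x') subrKA.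
by apply: idealD; apply: idealM; apply: repr_quot_pi.
Qed.

Let quot_addA : associative quot_add.
Proof. by do 3!elim/quotW=> ?; rewrite !quot_addE addrA. Qed.
Let quot_addC : commutative quot_add.
Proof. by do 2!elim/quotW=> ?; rewrite !quot_addE addrC. Qed.
Let quot_add0 : left_id (quot_pi 0) quot_add.
Proof. by elim/quotW=> ?; rewrite quot_addE add0r. Qed.
Let quot_addN : left_inverse (quot_pi 0) quot_opp quot_add.
Proof. by elim/quotW=> ?; rewrite quot_oppE quot_addE addNr. Qed.
HB.instance Definition _ :=
  GRing.isZmodule.Build quot quot_addA quot_addC quot_add0 quot_addN.

Let quot_mulA : associative quot_mul.
Proof. by do 3!elim/quotW=> ?; rewrite !quot_mulE mulrA. Qed.
Let quot_mulC : commutative quot_mul.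
Proof. by do 2!elim/quotW=> ?; rewrite !quot_mulE mulrC. Qed.
Let quot_mul1 : left_id (quot_pi 1) quot_mul.
Proof. by elim/quotW=> ?; rewrite quot_mulE mul1r. Qed.
Let quot_mulD : left_distributive quot_mul quot_add.
Proof. by do 3!elim/quotW=> ?; rewrite !(quot_mulE, quot_addE) mulrDl. Qed.
HB.instance Definition _ :=
  GRing.Zmodule_isComPzRing.Build quot quot_mulA quot_mulC quot_mul1 quot_mulD.

Lemma quot_pi_is_zmod_morphism : zmod_morphism quot_pi.
Proof. by move=> x y; rewrite -[RHS]/(quot_add _ (quot_opp _)) quot_oppE quot_addE. Qed.
Lemma quot_pi_is_monoid_morphism : monoid_morphism quot_pi.
Proof. by split=> // x y; rewrite -[RHS]/(quot_mul _ _) quot_mulE. Qed.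
HB.instance Definition _ :=
  GRing.isZmodMorphism.Build R quot quot_pi quot_pi_is_zmod_morphism.
HB.instance Definition _ :=
  GRing.isMonoidMorphism.Build R quot quot_pi quot_pi_is_monoid_morphism.

End Quotient.

(* The morphism R / f^-1(I) -> S / I induced by f : R -> S. *)
Section QuotientMap.
Variables (R S : comPzRingType) (f : {rmorphism R -> S}) (I : ideal S).

Definition quot_map (q : quot (ideal_preim f I)) : quot I :=
  quot_pi I (f (repr q)).

Lemma quot_mapE x : quot_map (quot_pi _ x) = quot_pi I (f x).
Proof.
apply/esym/eqP/quot_piP; rewrite -rmorphB.
exact: (@repr_quot_pi _ (ideal_preim f I)).
Qed.

Lemma quot_map_is_zmod_morphism : zmod_morphism quot_map.
Proof. by do 2!elim/quotW=> ?; rewrite -rmorphB !quot_mapE !rmorphB. Qed.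
Lemma quot_map_is_monoid_morphism : monoid_morphism quot_map.
Proof.
split; first by rewrite -(rmorph1 (quot_pi _)) quot_mapE !rmorph1.
by do 2!elim/quotW=> ?; rewrite -rmorphM !quot_mapE !rmorphM.
Qed.
HB.instance Definition _ :=
  GRing.isZmodMorphism.Build _ _ quot_map quot_map_is_zmod_morphism.
HB.instance Definition _ :=
  GRing.isMonoidMorphism.Build _ _ quot_map quot_map_is_monoid_morphism.

End QuotientMap.
Arguments quot_map [R S] f I q.

(* The ring of fractions R_a; the pair (x, i) stands for x / a ^ i. *)
Section Localisation.
Variables (R : comPzRingType) (a : R).

Definition loc_equiv (p q : R * nat) : bool :=
  `[< exists l, a ^+ l * (p.1 * a ^+ q.2) = a ^+ l * (q.1 * a ^+ p.2) >].

Lemma loc_equiv_is_equiv : equiv_class_of loc_equiv.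
Proof.
split=> [p|p q|q p r].
- by apply/asboolP; exists 0%N.
- by apply/asboolP/asboolP => -[l hl]; exists l.
move=> /asboolP[l hl] /asboolP[l' hl']; apply/asboolP.
exists (l + l' + q.2)%N; rewrite !exprD.
have -> : a ^+ l * a ^+ l' * a ^+ q.2 * (p.1 * a ^+ r.2) =
    a ^+ l' * a ^+ r.2 * (a ^+ l * (p.1 * a ^+ q.2)).
  by rewrite !mulrA [LHS](AC 5 (2*5*1*4*3)).
have -> : a ^+ l * a ^+ l' * a ^+ q.2 * (r.1 * a ^+ p.2) =
    a ^+ l * a ^+ p.2 * (a ^+ l' * (r.1 * a ^+ q.2)).
  by rewrite !mulrA [LHS](AC 5 (1*5*2*4*3)).
by rewrite hl -hl' !mulrA [LHS](AC 5 (3*5*1*4*2)).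
Qed.

Canonical loc_equiv_equiv := EquivRelPack loc_equiv_is_equiv.

Definition loc := {eq_quot loc_equiv}.
HB.instance Definition _ := Choice.on loc.
HB.instance Definition _ : EqQuotient (R * nat)%type loc_equiv loc := EqQuotient.on loc.

Definition loc_frac (x : R) (i : nat) : loc := \pi_loc (x, i).

Lemma loc_fracP x i y j :
  loc_frac x i = loc_frac y j <->
  exists l, a ^+ l * (x * a ^+ j) = a ^+ l * (y * a ^+ i).
Proof. by split=> [/eqquotP/asboolP|h] //; apply/eqquotP/asboolP. Qed.

Lemma loc_fracK (p : loc) : loc_frac (repr p).1 (repr p).2 = p.
Proof. by rewrite /loc_frac -surjective_pairing; apply: reprK. Qed.

Lemma locW (P : loc -> Prop) : (forall x i, P (loc_frac x i)) -> forall p, P p.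
Proof. by move=> h p; rewrite -(loc_fracK p). Qed.

Lemma repr_loc_frac x i : exists l,
  a ^+ l * ((repr (loc_frac x i)).1 * a ^+ i) =
  a ^+ l * (x * a ^+ (repr (loc_frac x i)).2).
Proof. by apply/loc_fracP; apply: loc_fracK. Qed.

Definition loc_add (p q : loc) :=
  loc_frac ((repr p).1 * a ^+ (repr q).2 + (repr q).1 * a ^+ (repr p).2)
           ((repr p).2 + (repr q).2).
Definition loc_opp (p : loc) := loc_frac (- (repr p).1) (repr p).2.
Definition loc_mul (p q : loc) :=
  loc_frac ((repr p).1 * (repr q).1) ((repr p).2 + (repr q).2).

Lemma loc_addE x i y j :
  loc_add (loc_frac x i) (loc_frac y j) =
  loc_frac (x * a ^+ j + y * a ^+ i) (i + j).
Proof.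
have [l hl] := repr_loc_frac x i; have [l' hl'] := repr_loc_frac y j.
rewrite /loc_add; move: (repr (loc_frac x i)) (repr (loc_frac y j)) hl hl'.
move=> [x' i'] [y' j'] /= hl hl'; apply/loc_fracP; exists (l + l')%N.
rewrite !exprD !mulrDl !mulrDr; congr (_ + _).
  have -> : a ^+ l * a ^+ l' * (x' * a ^+ j' * (a ^+ i * a ^+ j)) =
      a ^+ l * (x' * a ^+ i) * (a ^+ l' * a ^+ j' * a ^+ j).
    by rewrite !mulrA [LHS](AC 6 (1*3*5*2*4*6)).
  by rewrite hl !mulrA [LHS](AC 6 (1*4*2*6*3*5)).
have -> : a ^+ l * a ^+ l' * (y' * a ^+ i' * (a ^+ i * a ^+ j)) =
    a ^+ l' * (y' * a ^+ j) * (a ^+ l * a ^+ i' * a ^+ i).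
  by rewrite !mulrA [LHS](AC 6 (2*3*6*1*4*5)).
by rewrite hl' !mulrA [LHS](AC 6 (4*1*2*6*5*3)).
Qed.

Lemma loc_oppE x i : loc_opp (loc_frac x i) = loc_frac (- x) i.
Proof.
have [l hl] := repr_loc_frac x i; apply/loc_fracP; exists l.
by rewrite !mulNr !mulrN hl.
Qed.

Lemma loc_mulE x i y j :
  loc_mul (loc_frac x i) (loc_frac y j) = loc_frac (x * y) (i + j).
Proof.
have [l hl] := repr_loc_frac x i; have [l' hl'] := repr_loc_frac y j.
rewrite /loc_mul; move: (repr (loc_frac x i)) (repr (loc_frac y j)) hl hl'.
move=> [x' i'] [y' j'] /= hl hl'; apply/loc_fracP; exists (l + l')%N.
have -> : a ^+ (l + l') * (x' * y' * a ^+ (i + j)) =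
    a ^+ l * (x' * a ^+ i) * (a ^+ l' * (y' * a ^+ j)).
  by rewrite !exprD !mulrA [LHS](AC 6 (1*3*5*2*4*6)).
by rewrite hl hl' !exprD !mulrA [LHS](AC 6 (1*4*2*5*3*6)).
Qed.

Let loc_addA : associative loc_add.
Proof.
elim/locW=> x i; elim/locW=> y j; elim/locW=> z o; rewrite !loc_addE addnA.
congr (loc_frac _ _); rewrite !exprD !mulrDl !mulrA -!addrA.
by rewrite (mulrAC x) (mulrAC y) [z * _ * _]mulrAC.
Qed.
Let loc_addC : commutative loc_add.
Proof. by elim/locW=> x i; elim/locW=> y j; rewrite !loc_addE addrC addnC. Qed.
Let loc_add0 : left_id (loc_frac 0 0) loc_add.
Proof. by elim/locW=> x i; rewrite loc_addE mul0r add0r expr0 mulr1. Qed.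
Let loc_addN : left_inverse (loc_frac 0 0) loc_opp loc_add.
Proof.
elim/locW=> x i; rewrite loc_oppE loc_addE mulNr addNr.
by apply/loc_fracP; exists 0%N; rewrite !mul0r.
Qed.
HB.instance Definition _ :=
  GRing.isZmodule.Build loc loc_addA loc_addC loc_add0 loc_addN.

Let loc_mulA : associative loc_mul.
Proof.
by elim/locW=> x i; elim/locW=> y j; elim/locW=> z o; rewrite !loc_mulE mulrA addnA.
Qed.
Let loc_mulC : commutative loc_mul.
Proof. by elim/locW=> x i; elim/locW=> y j; rewrite !loc_mulE mulrC addnC. Qed.
Let loc_mul1 : left_id (loc_frac 1 0) loc_mul.
Proof. by elim/locW=> x i; rewrite loc_mulE mul1r. Qed.
Let loc_mulD : left_distributive loc_mul loc_add.
Proof.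
elim/locW=> x i; elim/locW=> y j; elim/locW=> z o.
rewrite !(loc_mulE, loc_addE); apply/loc_fracP; exists 0%N.
rewrite !exprD !mulrDl !mul1r !mulrA.
by congr (_ + _); rewrite [LHS](AC 7 (1*3*2*5*4*6*7)).
Qed.
HB.instance Definition _ :=
  GRing.Zmodule_isComPzRing.Build loc loc_mulA loc_mulC loc_mul1 loc_mulD.

Lemma loc_fracD x i y j :
  loc_frac x i + loc_frac y j = loc_frac (x * a ^+ j + y * a ^+ i) (i + j).
Proof. exact: loc_addE. Qed.
Lemma loc_fracN x i : - loc_frac x i = loc_frac (- x) i.
Proof. exact: loc_oppE. Qed.
Lemma loc_fracM x i y j : loc_frac x i * loc_frac y j = loc_frac (x * y) (i + j).
Proof. exact: loc_mulE. Qed.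

End Localisation.

(* The morphism R_a -> S_f(a) induced by f : R -> S. *)
Section LocalisationMap.
Variables (R S : comPzRingType) (f : {rmorphism R -> S}) (a : R).

Definition loc_map (p : loc a) : loc (f a) := loc_frac (f a) (f (repr p).1) (repr p).2.

Lemma loc_mapE x i : loc_map (loc_frac a x i) = loc_frac (f a) (f x) i.
Proof.
have [l hl] := repr_loc_frac a x i; apply/loc_fracP; exists l.
by rewrite -!rmorphXn -!rmorphM hl.
Qed.

Lemma loc_map_is_zmod_morphism : zmod_morphism loc_map.
Proof.
elim/locW=> x i; elim/locW=> y j.
rewrite loc_fracN loc_fracD !loc_mapE loc_fracN loc_fracD.
by rewrite rmorphD !rmorphM !rmorphXn rmorphN.
Qed.
Lemma loc_map_is_monoid_morphism : monoid_morphism loc_map.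
Proof.
split; first by rewrite -[1]/(loc_frac a 1 0) loc_mapE rmorph1.
by elim/locW=> x i; elim/locW=> y j; rewrite loc_fracM !loc_mapE loc_fracM rmorphM.
Qed.
HB.instance Definition _ :=
  GRing.isZmodMorphism.Build _ _ loc_map loc_map_is_zmod_morphism.
HB.instance Definition _ :=
  GRing.isMonoidMorphism.Build _ _ loc_map loc_map_is_monoid_morphism.

End LocalisationMap.

Arguments loc_map [R S] f a p.

(** * Finite modules, flat modules, spectra *)

(* S as an R-module through phi. *)
Definition restr (R S : comPzRingType) (phi : {rmorphism R -> S}) : Type := S.

Section RestrictionOfScalars.
Variables (R S : comPzRingType) (phi : {rmorphism R -> S}).

HB.instance Definition _ := GRing.Zmodule.on (restr phi).

Definition restr_scale (r : R) (x : restr phi) : restr phi := phi r * (x : S).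

Let restr_scaleA a b v : restr_scale a (restr_scale b v) = restr_scale (a * b) v.
Proof. by rewrite /restr_scale rmorphM mulrA. Qed.
Let restr_scale1 : left_id 1 restr_scale.
Proof. by move=> v; rewrite /restr_scale rmorph1 mul1r. Qed.
Let restr_scaleDr : right_distributive restr_scale +%R.
Proof. by move=> r u v; apply: mulrDr. Qed.
Let restr_scaleDl v : {morph restr_scale^~ v : a b / a + b}.
Proof. by move=> r r'; rewrite /restr_scale rmorphD; apply: mulrDl. Qed.
HB.instance Definition _ := GRing.Zmodule_isLmodule.Build R (restr phi)
  restr_scaleA restr_scale1 restr_scaleDr restr_scaleDl.

End RestrictionOfScalars.

Definition finite_module (R : comPzRingType) (M : lmodType R) : Prop :=
  exists (l : nat) (b : 'I_l -> M),
    forall v : M, exists c : 'I_l -> R, v = \sum_(i < l) c i *: b i.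

Definition is_bilinear (R : comPzRingType) (M N P : lmodType R)
    (b : M -> N -> P) : Prop :=
  (forall v, linear (b v)) /\ (forall w, linear (b^~ w)).

(* The tensor v_1 (x) w_1 + ... + v_l (x) w_l vanishes in M (x)_R N: by the
   universal property of the tensor product, this means that it is killed by
   every bilinear map on M x N. *)
Definition tensor_eq0 (R : comPzRingType) (M N : lmodType R) (l : nat)
    (v : 'I_l -> M) (w : 'I_l -> N) : Prop :=
  forall (P : lmodType R) (b : M -> N -> P),
    is_bilinear b -> \sum_(i < l) b (v i) (w i) = 0.

(* M (x) f is injective for every injective linear map f. *)
Definition flat_module (R : comPzRingType) (M : lmodType R) : Prop :=
  forall (N N' : lmodType R) (f : {linear N -> N'}), injective f ->
  forall (l : nat) (v : 'I_l -> M) (w : 'I_l -> N),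
    tensor_eq0 v (f \o w) -> tensor_eq0 v w.

Record Spec (R : comPzRingType) := SpecPoint {
  spec_ideal :> ideal R;
  spec_proper : ~ spec_ideal 1;
  spec_prime : forall x y, spec_ideal (x * y) -> spec_ideal x \/ spec_ideal y }.

Section Spectrum.
Variable R : comPzRingType.

Definition zero_locus (X : set R) : set (Spec R) := [set P : Spec R | X `<=` P].
Definition basic_open (a : R) : set (Spec R) := [set P : Spec R | ~ P a].
Definition spec_open (U : set (Spec R)) : Prop := exists X : set R, U = ~` zero_locus X.

Definition is_largest_open (Q : set (Spec R) -> Prop) (U : set (Spec R)) : Prop :=
  [/\ spec_open U, Q U & forall U', spec_open U' -> Q U' -> U' `<=` U].

End Spectrum.

(* Over the open set U, Spec S -> Spec R is finite flat: U is covered by affine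
   opens D(a) = Spec R_a, with preimage Spec S_phi(a), such that S_phi(a) is a
   finite and flat R_a-module. *)
Definition finite_flat_over (R S : comPzRingType) (phi : {rmorphism R -> S})
    (U : set (Spec R)) : Prop :=
  forall P, U P -> exists a : R,
    [/\ basic_open a P, basic_open a `<=` U,
        finite_module (restr (loc_map phi a)) &
        flat_module (restr (loc_map phi a))].

(** * Monomial orders and Groebner bases *)

Section MonomialOrders.
Variable n : nat.
Implicit Type T : rel 'X_{1..n}.

(* [T u v] means u <= v; such an order is automatically a well-order. *)
Definition monomial_order T : Prop :=
  [/\ total T, antisymmetric T, transitive T, forall u, T 0%MM u &
      forall u v w, T u v -> T (u + w)%MM (v + w)%MM].

Definition degree_compatible T : Prop :=
  forall u v, T u v -> (mdeg u <= mdeg v)%N.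

(* For p != 0, the T-largest monomial in the support of p; lm T 0 = 0. *)
Definition lm (R : nzRingType) T (p : {mpoly R[n]}) : 'X_{1..n} :=
  \big[(fun u v => if T u v then v else u)/0%MM]_(u <- msupp p) u.

(* On 'X_{1..n}, [(u <= v)%MM] is divisibility. *)
Definition groebner_basis (k : fieldType) T (I : ideal {mpoly k[n]})
    (G : seq {mpoly k[n]}) : Prop :=
  (forall g, g \in G -> I g) /\
  (forall f, I f -> f != 0 ->
     exists g, [/\ g \in G, g != 0 & (lm T g <= lm T f)%MM]).

End MonomialOrders.

(* The variables of a block are given by a map f from the indices of the block
   to the indices of all variables. *)
Section Blocks.
Variables (a N : nat) (f : 'I_a -> 'I_N).

Definition mrestr (u : 'X_{1..N}) : 'X_{1..a} := [multinom u (f i) | i < a].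

Definition order_on (T : rel 'X_{1..a}) : rel 'X_{1..N} :=
  fun u v => T (mrestr u) (mrestr v).

(* T on the block f, ties being broken by T'. *)
Definition block_order (T : rel 'X_{1..a}) (T' : rel 'X_{1..N}) : rel 'X_{1..N} :=
  fun u v => if mrestr u == mrestr v then T' u v else T (mrestr u) (mrestr v).

Definition rename (R : comNzRingType) : {mpoly R[a]} -> {mpoly R[N]} :=
  comp_mpoly [tuple 'X_(f i) | i < a].

HB.instance Definition _ (R : comNzRingType) :=
  GRing.RMorphism.copy (@rename R) (comp_mpoly [tuple 'X_(f i) | i < a]).

End Blocks.
Arguments rename [a N] f {R} p.

Section Variables.
Variables (R : nzRingType) (N : nat) (V : pred 'I_N).

Definition only_vars (p : {mpoly R[N]}) : bool :=
  all (fun u : 'X_{1..N} => [forall i, V i || (u i == 0%N)]) (msupp p).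

Definition mdeg_in (u : 'X_{1..N}) : nat := \sum_(i < N | V i) u i.

(* The degree in the variables V, with deg_in 0 = 0. *)
Definition deg_in (p : {mpoly R[N]}) : nat := \max_(u <- msupp p) mdeg_in u.

Definition homogeneous_in (p : {mpoly R[N]}) : Prop :=
  exists d, forall u, u \in msupp p -> mdeg_in u = d.

End Variables.

Section Minors.
Variables (R : comNzRingType) (r s : nat) (N : 'M[R]_(r, s)).

Definition minors (j : nat) : set R :=
  [set d | exists (f : 'I_j -> 'I_r) (g : 'I_j -> 'I_s),
    [/\ {homo f : x y / (x < y)%N}, {homo g : x y / (x < y)%N} &
        d = \det (mxsub f g N)]].

End Minors.

(** * The objects attached to I *)

(* k[y, x] is {mpoly k[m + n]}, the variables y coming first. *)
Section Elimination.
Variables (k : fieldType) (m n : nat) (I : ideal {mpoly k[m + n]}).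

Definition incl_y : {rmorphism {mpoly k[m]} -> {mpoly k[m + n]}} :=
  rename (@lshift m n).

Definition elim_ideal : ideal {mpoly k[m]} := ideal_preim incl_y I.

Definition ringA := quot elim_ideal.
Definition ringB := quot I.
Definition mapAB : {rmorphism ringA -> ringB} := quot_map incl_y I.

(* V(X) in Spec A, for a subset X of k[y]. *)
Definition VA (X : set {mpoly k[m]}) : set (Spec ringA) :=
  zero_locus (quot_pi elim_ideal @` X).

(* J_i; here k[y, x_i] is {poly {mpoly k[m]}}. *)
Definition lc_ideal (i : 'I_n) : set {mpoly k[m]} :=
  [set lead_coef p | p in
    [set p : {poly {mpoly k[m]}} | I (map_poly incl_y p).['X_(rshift m i)]]].

Definition nonfinite_locus : set (Spec ringA) :=
  \bigcup_(i in [set: 'I_n]) VA (lc_ideal i).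

(* F_i, for -1 <= i <= r. *)
Definition minors_ideal (r s : nat) (N : 'M[{mpoly k[m]}]_(r, s)) (i : int) :
    ideal {mpoly k[m]} :=
  ideal_span (elim_ideal `|` minors N `|r%:Z - i|%N).

Definition flatness_ideal (r s : nat) (N : 'M[{mpoly k[m]}]_(r, s)) :
    ideal {mpoly k[m]} :=
  ideal_span (\bigcup_(i in [set i | (i <= r)%N])
    (colon elim_ideal (minors_ideal N (i%:Z - 1)) `&` minors_ideal N i%:Z)).

End Elimination.
Arguments VA [k m n] I X _.
Arguments nonfinite_locus [k m n] I _.

Section LeadingTerms.
Variables (k : fieldType) (m n : nat).

(* k[y, x] -> k[y][x] *)
Definition poly_in_x (p : {mpoly k[m + n]}) : {mpoly {mpoly k[m]}[n]} :=
  mmap (@mpolyC n {mpoly k[m]} \o @mpolyC m k)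
    (fun i => match split i with inl j => ('X_j)%:MP | inr j => 'X_j end) p.

Definition block_order_xy (Tx : rel 'X_{1..n}) (Ty : rel 'X_{1..m}) :
    rel 'X_{1..m + n} :=
  block_order (@rshift m n) Tx (order_on (@lshift m n) Ty).

Variables (Tx : rel 'X_{1..n}) (G : seq {mpoly k[m + n]}).

Definition basis_x : seq {mpoly k[m + n]} :=
  [seq g <- G | ~~ only_vars (fun i : 'I_(m + n) => (i < m)%N) g].

(* P_i; the exponent d(g) is the exponent of x_i in LM(g). *)
Definition pure_power_basis (i : 'I_n) : seq {mpoly k[m + n]} :=
  [seq g <- basis_x | let u := lm Tx (poly_in_x g) in
     (0 < u i)%N && (u == (U_(i) *+ u i)%MM)].

(* t_i *)
Definition max_power (i : 'I_n) : nat :=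
  \max_(g <- pure_power_basis i) lm Tx (poly_in_x g) i.

End LeadingTerms.

(* k[y, x, t, u] is {mpoly k[m + n + (1 + r)]}, in this order. *)
Section Presentation.
Variables (k : fieldType) (m n r : nat).

Definition var_yx (i : 'I_(m + n)) : 'I_(m + n + (1 + r)) := lshift (1 + r) i.
Definition var_y (i : 'I_m) := var_yx (lshift n i).
Definition var_x (i : 'I_n) := var_yx (rshift m i).
Definition var_t : 'I_(m + n + (1 + r)) := rshift (m + n) (lshift r ord0).
Definition var_u (i : 'I_r) : 'I_(m + n + (1 + r)) := rshift (m + n) (rshift 1 i).
Definition var_xt (i : 'I_(n + 1)) : 'I_(m + n + (1 + r)) :=
  match split i with inl j => var_x j | inr _ => var_t end.

Definition block_order_xtuy (Txt : rel 'X_{1..n + 1}) (Tu : rel 'X_{1..r})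
    (Ty : rel 'X_{1..m}) : rel 'X_{1..m + n + (1 + r)} :=
  block_order var_xt Txt (block_order var_u Tu (order_on var_y Ty)).

Definition is_var_u (i : 'I_(m + n + (1 + r))) : bool := (m + n < i)%N.
Definition is_var_tu (i : 'I_(m + n + (1 + r))) : bool := (m + n <= i)%N.
Definition is_var_yu (i : 'I_(m + n + (1 + r))) : bool := (i < m)%N || is_var_u i.

(* The ideal L, for the list mon of monomials in x. *)
Definition ideal_L (I : ideal {mpoly k[m + n]}) (mon : r.-tuple 'X_{1..n}) :
    ideal {mpoly k[m + n + (1 + r)]} :=
  ideal_span ((rename var_yx @` I) `|`
    [set 'X_(var_u j) - 'X_var_t * rename var_x 'X_[tnth mon j] | j in [set: 'I_r]]).

(* The columns of N are the u-linear elements of H in k[y, u], in some order. *)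
Definition presentation_matrix (H : seq {mpoly k[m + n + (1 + r)]}) (s : nat)
    (N : 'M[{mpoly k[m]}]_(r, s)) : Prop :=
  exists h : s.-tuple {mpoly k[m + n + (1 + r)]},
    [/\ uniq h,
        forall p, p \in h =
          [&& p \in H, only_vars is_var_yu p & deg_in is_var_u p == 1%N] &
        forall j, tnth h j = \sum_(i < r) rename var_y (N i j) * 'X_(var_u i)].

End Presentation.

(* Main.v *)
Require Import Defs.
From HB Require Import structures.
From mathcomp Require Import all_boot all_order all_algebra generic_quotient.
From mathcomp Require Import boolp classical_sets.
From mathcomp Require Import perm mpoly ring.

(* Put R = k[y].  The block order makes G a Groebner basis over R: if f in I has
   Tx-leading term c x^al, then c is an R-combination of the LC(g) with LM(g)
   dividing x^al.  At a prime P outside W this gives, for every i, some g in P_i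
   with LC(g) not in P, hence after inverting these coefficients the monomials
   m_j generate B, by induction on Tx.  Their relations are the columns of N
   together with J^r, by reduction modulo H.  Conversely, finiteness over a
   neighbourhood of P puts P outside W, by Cayley-Hamilton.

   So everything happens for a finitely presented module coker N, and the bridge
   is the regularity of N: coker N is flat iff N = N C N for some C.  If F is not
   contained in P, then after inverting an element outside P some q-minor of N is
   invertible and all (q+1)-minors vanish, so the Schur complement of that minor
   vanishes, which is such an identity.  If N = N C N locally at P and q is the
   rank of N modulo P, then the Schur complement X of a q-minor outside P has
   entries in P and satisfies X = X C' X, so it is killed by an element outside P
   (Nakayama), and so are all (q+1)-minors. *)

Set Implicit Arguments.
Unset Strict Implicit.
Unset Printing Implicit Defensive.

Import GRing.Theory.
Local Open Scope ring_scope.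
Local Open Scope classical_set_scope.
Local Open Scope quotient_scope.

(** * Ideals, primes, and the pull-back of primes along a quotient map *)

Lemma ideal_mulr (R : comPzRingType) (I : ideal R) x a : I x -> I (x * a).
Proof. by move=> Ix; rewrite mulrC; apply: idealM. Qed.

Section Prime.
Variables (R : comPzRingType) (P : Spec R).

Lemma spec_notM x y : ~ P x -> ~ P y -> ~ P (x * y).
Proof. by move=> hx hy /spec_prime[]. Qed.

Lemma spec_notX l x : ~ P x -> ~ P (x ^+ l).
Proof.
move=> hx; elim: l => [|l IHl]; first by rewrite expr0; apply: spec_proper.
by rewrite exprS; apply: spec_notM.
Qed.

Lemma spec_not_prod (T : finType) (F : T -> R) :
  (forall i, ~ P (F i)) -> ~ P (\prod_i F i).
Proof.
move=> hF; elim/big_ind: _ => [|x y|i _]; [exact: spec_proper | exact: spec_notM |].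
exact: hF.
Qed.

End Prime.

Lemma quot_pi_eq0 (R : comPzRingType) (K : ideal R) x : quot_pi K x = 0 <-> K x.
Proof.
rewrite -(rmorph0 (quot_pi K)); split=> [/eqP/quot_piP|Kx]; first by rewrite subr0.
by apply/eqP/quot_piP; rewrite subr0.
Qed.

Lemma sub_ideal_span (R : comPzRingType) (X : set R) x : X x -> ideal_span X x.
Proof. by move=> Xx; change (span_set X x) => K; apply. Qed.

Section PullBack.
Variables (R : comPzRingType) (K : ideal R) (P : Spec (quot K)).

Lemma pull_back_proper : ~ ideal_preim (quot_pi K) P 1.
Proof. by rewrite /ideal_preim /preimage /= rmorph1; apply: spec_proper. Qed.

Lemma pull_back_prime x y : ideal_preim (quot_pi K) P (x * y) ->
  ideal_preim (quot_pi K) P x \/ ideal_preim (quot_pi K) P y.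
Proof. by rewrite /ideal_preim /preimage /= rmorphM => /spec_prime. Qed.

(** Points of Spec A are handled through these primes of k[y], which contain J, so that all choices
    of elements outside a point take place in k[y]. *)
Definition pull_back : Spec R := SpecPoint pull_back_proper pull_back_prime.

Lemma sub_pull_back x : K x -> pull_back x.
Proof.
by move=> /quot_pi_eq0 Kx; rewrite /pull_back /preimage /= Kx; apply: ideal0.
Qed.

End PullBack.
(** * Flat modules and presentation matrices *)

(** Membership is a mere proposition: the submodule that is divided out below, [sandwich], is given
    by an existential. *)
Record submodule (R : comPzRingType) (V : lmodType R) := Submodule {
  submodule_set : V -> Prop;
  submodule0 : submodule_set 0;
  submoduleD : forall u v, submodule_set u -> submodule_set v -> submodule_set (u + v);
  submoduleZ : forall a u, submodule_set u -> submodule_set (a *: u) }.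
Coercion submodule_set : submodule >-> Funclass.

Section ModuleQuotient.
Variables (R : comPzRingType) (V : lmodType R) (S : submodule V).

Let subN u : S u -> S (- u).
Proof. by rewrite -scaleN1r; apply: submoduleZ. Qed.

Definition mod_equiv (u v : V) : bool := `[< S (u - v) >].

Lemma mod_equiv_is_equiv : equiv_class_of mod_equiv.
Proof.
split=> [u|u v|v u w].
- by apply/asboolP; rewrite subrr; apply: submodule0.
- by apply/asboolP/asboolP => /subN; rewrite opprB.
move=> /asboolP uv /asboolP vw; apply/asboolP.
by rewrite -(subrKA v); apply: submoduleD.
Qed.

Canonical mod_equiv_equiv := EquivRelPack mod_equiv_is_equiv.

Definition mod_quot := {eq_quot mod_equiv}.
HB.instance Definition _ := Choice.on mod_quot.
HB.instance Definition _ : EqQuotient V mod_equiv mod_quot := EqQuotient.on mod_quot.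

Definition mod_pi (u : V) : mod_quot := \pi_mod_quot u.

Lemma mod_piP u v : mod_pi u = mod_pi v <-> S (u - v).
Proof. by split=> [/eqquotP/asboolP|h] //; apply/eqquotP/asboolP. Qed.

Lemma mod_piW (P : mod_quot -> Prop) : (forall u, P (mod_pi u)) -> forall q, P q.
Proof. by move=> h q; rewrite -[q]reprK; apply: h. Qed.

Lemma repr_mod_pi u : S (repr (mod_pi u) - u).
Proof. by apply/mod_piP; apply: reprK. Qed.

Let add (p q : mod_quot) := mod_pi (repr p + repr q).
Let opp (p : mod_quot) := mod_pi (- repr p).
Let scale (a : R) (p : mod_quot) := mod_pi (a *: repr p).

Let addE u v : add (mod_pi u) (mod_pi v) = mod_pi (u + v).
Proof.
by apply/mod_piP; rewrite opprD addrACA; apply: submoduleD; apply: repr_mod_pi.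
Qed.
Let oppE u : opp (mod_pi u) = mod_pi (- u).
Proof. by apply/mod_piP; rewrite -opprD; apply/subN/repr_mod_pi. Qed.
Let scaleE a u : scale a (mod_pi u) = mod_pi (a *: u).
Proof. by apply/mod_piP; rewrite -scalerBr; apply/submoduleZ/repr_mod_pi. Qed.

Let addA : associative add.
Proof. by do 3!elim/mod_piW=> ?; rewrite !addE addrA. Qed.
Let addC : commutative add.
Proof. by do 2!elim/mod_piW=> ?; rewrite !addE addrC. Qed.
Let add0 : left_id (mod_pi 0) add.
Proof. by elim/mod_piW=> ?; rewrite addE add0r. Qed.
Let addN : left_inverse (mod_pi 0) opp add.
Proof. by elim/mod_piW=> ?; rewrite oppE addE addNr. Qed.
HB.instance Definition _ := GRing.isZmodule.Build mod_quot addA addC add0 addN.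

Let scaleA a b p : scale a (scale b p) = scale (a * b) p.
Proof. by elim/mod_piW: p => ?; rewrite !scaleE scalerA. Qed.
Let scale1 : left_id 1 scale.
Proof. by elim/mod_piW=> ?; rewrite scaleE scale1r. Qed.
Let scaleDr : right_distributive scale +%R.
Proof.
move=> a; do 2!elim/mod_piW=> ?.
by rewrite -[_ + _]/(add _ _) addE !scaleE scalerDr -[RHS]/(add _ _) addE.
Qed.
Let scaleDl p : {morph scale^~ p : a b / a + b}.
Proof.
move=> a b; elim/mod_piW: p => ?.
by rewrite !scaleE scalerDl -[RHS]/(add _ _) addE.
Qed.
HB.instance Definition _ := GRing.Zmodule_isLmodule.Build R mod_quot
  scaleA scale1 scaleDr scaleDl.

Lemma mod_pi_linear : linear mod_pi.
Proof.
by move=> a u v; rewrite -[RHS]/(add (scale _ _) _) scaleE addE.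
Qed.
HB.instance Definition _ := GRing.isLinear.Build R V mod_quot _ mod_pi mod_pi_linear.

End ModuleQuotient.

Lemma linear_comb (R : comPzRingType) (U V : lmodType R) (f : U -> V) :
  linear f -> forall n (c : 'I_n -> R) (u : 'I_n -> U),
  f (\sum_(i < n) c i *: u i) = \sum_(i < n) c i *: f (u i).
Proof.
move=> linf n c u; have f0 : f 0 = 0.
  by have := linf (- 1) 0 0; rewrite scaler0 addr0 scaleN1r addNr.
elim: n c u => [|n IHn] c u; first by rewrite !big_ord0.
by rewrite !big_ord_recl linf IHn.
Qed.

(* The coordinate forms phi_i need not be dual to a basis: such a module is
   projective, not necessarily free. *)
Lemma flat_dual_basis (R : comPzRingType) (M : lmodType R) (r : nat)
    (e : 'I_r -> M) (phi : M -> 'I_r -> R) :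
  (forall i a u v, phi (a *: u + v) i = a * phi u i + phi v i) ->
  (forall v, v = \sum_(i < r) phi v i *: e i) -> flat_module M.
Proof.
move=> linphi phiE N N' f injf l v w tens P b [br bl].
(* The bilinear map (u, x) |-> phi_i(u) x turns the vanishing of the tensor over [N'] into equations
   in [N'], which the injectivity of [f] brings back to [N]. *)
have coord0 i : \sum_(j < l) phi (v j) i *: w j = 0.
  apply: injf; rewrite linear_sum linear0.
  have bil : is_bilinear (fun (u : M) (x : N') => phi u i *: x).
    split=> [u a x y|x a u u'] /=; first by rewrite scalerDr !scalerA mulrC.
    by rewrite linphi scalerDl scalerA.
  by rewrite -[RHS](tens _ _ bil); apply: eq_bigr => j _; rewrite linearZ.
have -> : \sum_(j < l) b (v j) (w j) =
    \sum_(i < r) b (e i) (\sum_(j < l) phi (v j) i *: w j).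
  under [RHS]eq_bigr => i _ do rewrite (linear_comb (br _)).
  rewrite exchange_big; apply: eq_bigr => j _ /=.
  by rewrite {1}[v j]phiE (linear_comb (bl _)).
apply: big1 => i _; rewrite coord0.
by have := linear_comb (br (e i)) (n := 0) (fun=> 0) (fun=> 0); rewrite !big_ord0.
Qed.

Section RowImage.
Variables (R : comPzRingType) (r s : nat) (N : 'M[R]_(r, s)).

(** A boolean predicate, so that the row space is a sub-module type whose inclusion [val] is an
    injective linear map. *)
Definition in_row_image : pred 'rV[R]_s := fun x => `[< exists e, x = e *m N >].

Lemma in_row_image_closed : submod_closed in_row_image.
Proof.
split=> [|a x y /asboolP[e ->] /asboolP[e' ->]]; apply/asboolP.
  by exists 0; rewrite mul0mx.
by exists (a *: e + e'); rewrite mulmxDl scalemxAl.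
Qed.
HB.instance Definition _ :=
  GRing.isSubmodClosed.Build R 'rV[R]_s in_row_image in_row_image_closed.

Definition row_image := {x | in_row_image x}.
HB.instance Definition _ := SubChoice.on row_image.
HB.instance Definition _ := [SubChoice_isSubLmodule of row_image by <:].

End RowImage.

Section RegularMatrix.
Variables (R : comPzRingType) (r s : nat) (N : 'M[R]_(r, s)).

Let sandwich0 : exists C : 'M[R]_(s, r), 0 = N *m C *m N.
Proof. by exists 0; rewrite mulmx0 mul0mx. Qed.
Let sandwichD (X Y : 'M[R]_(r, s)) :
  (exists C : 'M[R]_(s, r), X = N *m C *m N) ->
  (exists C : 'M[R]_(s, r), Y = N *m C *m N) ->
  exists C : 'M[R]_(s, r), X + Y = N *m C *m N.
Proof. by move=> [C ->] [C' ->]; exists (C + C'); rewrite mulmxDr mulmxDl. Qed.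
Let sandwichZ a (X : 'M[R]_(r, s)) :
  (exists C : 'M[R]_(s, r), X = N *m C *m N) ->
  exists C : 'M[R]_(s, r), a *: X = N *m C *m N.
Proof. by move=> [C ->]; exists (a *: C); rewrite -scalemxAr -scalemxAl. Qed.

(** The class of d N modulo this submodule vanishes exactly when d N = N C N for some C. *)
Definition sandwich : submodule 'M[R]_(r, s) :=
  Submodule sandwich0 sandwichD sandwichZ.

(* Flatness is tested on the inclusion of the row space of N into R^s, with the
   bilinear map (sum_i c_i e_i / d, w) |-> c w modulo N R^(s x r) N. *)
Lemma flat_regular (M : lmodType R) (e : 'I_r -> M) (d : R) :
  flat_module M ->
  (forall v, exists c : 'cV[R]_r, d *: v = \sum_(i < r) c i ord0 *: e i) ->
  (forall c : 'cV[R]_r, \sum_(i < r) c i ord0 *: e i = 0 <->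
     exists x : 'cV[R]_s, c = N *m x) ->
  exists C : 'M[R]_(s, r), d *: N = N *m C *m N.
Proof.
move=> flatM gen rel.
have {gen}[c cP] := choice gen.
pose b (v : M) (w : row_image N) : mod_quot sandwich := mod_pi sandwich (c v *m val w).
(* The product depends on the vector only, not on its coordinates: the difference of two coordinate
   columns is N x, and w = y N, so the products differ by N (x y) N. *)
have cong (c1 c2 : 'cV[R]_r) (w : row_image N) :
    \sum_(i < r) c1 i ord0 *: e i = \sum_(i < r) c2 i ord0 *: e i ->
    mod_pi sandwich (c1 *m val w) = mod_pi sandwich (c2 *m val w).
  move=> h; apply/mod_piP; rewrite -mulmxBl.
  have [|x ->] := (rel (c1 - c2)).1.
    by under eq_bigr => i _ do rewrite !mxE scalerBl; rewrite sumrB h subrr.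
  by have /asboolP[y ->] := valP w; exists (x *m y); rewrite !mulmxA.
have bil : is_bilinear b.
  split=> [v a w w'|w a v v'] /=; rewrite /b.
    by rewrite !linearP /= -linearP.
  rewrite -linearP /= scalemxAl -mulmxDl; apply: cong.
  rewrite -cP scalerDr scalerA mulrC -scalerA !cP scaler_sumr -big_split /=.
  by apply: eq_bigr => i _; rewrite !mxE scalerDl scalerA.
have rowP i : in_row_image N (row i N).
  by apply/asboolP; exists (delta_mx ord0 i); rewrite rowE.
pose w i : row_image N := Sub (row i N) (rowP i).
have relN j : \sum_(i < r) N i j *: e i = 0.
  have /(rel _).2 : exists x : 'cV[R]_s, col j N = N *m x.
    by exists (delta_mx j ord0); rewrite colE.
  by under eq_bigr => i _ do rewrite mxE.
(* In M (x) R^s the sum of the e_i (x) (row i of N) equals the sum over j of (sum_i N_ij e_i) (x)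
   delta_j, which is 0; flatness carries this over to the row space. *)
have tens : tensor_eq0 e w.
  apply: (flatM (row_image N) 'rV[R]_s val val_inj) => P b' [br bl].
  transitivity (\sum_(i < r) \sum_(j < s) N i j *: b' (e i) (delta_mx ord0 j)).
    apply: eq_bigr => i _; rewrite /= [row i N]row_sum_delta (linear_comb (br _)).
    by apply: eq_bigr => j _; rewrite mxE.
  rewrite exchange_big big1 //= => j _.
  rewrite -(linear_comb (bl _)) relN.
  have := linear_comb (bl (delta_mx ord0 j)) (n := 0) (fun=> 0) (fun=> 0).
  by rewrite !big_ord0.
have := tens _ _ bil.
(* Both [c (e i)] and d delta_i are coordinates of d e_i, so the values of [b] add up to the class
   of d N. *)
have eE i : b (e i) (w i) = mod_pi sandwich (d *: (delta_mx i ord0 *m row i N)).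
  rewrite /b scalemxAl; apply: (cong _ _ (w i)); rewrite -cP.
  rewrite (bigD1 i) //= big1 => [|j ji]; rewrite !mxE ?eqxx ?mulr1 ?addr0 //.
  by rewrite (negPf ji) mulr0 scale0r.
under eq_bigr => i _ do rewrite eE.
rewrite -linear_sum -(linear0 (mod_pi sandwich)) => /mod_piP.
rewrite subr0 -scaler_sumr => -[C CE]; exists C; rewrite -CE; congr (_ *: _).
apply/matrixP=> i j; rewrite summxE (bigD1 i) //= big1 => [|k ki].
  by rewrite mxE big_ord1 !mxE !eqxx mul1r addr0.
by rewrite mxE big_ord1 !mxE eq_sym (negPf ki) mul0r.
Qed.

(* The relations of the e_i form a direct summand: c |-> c - N C c projects onto
   a complement. *)
Lemma regular_flat (M : lmodType R) (e : 'I_r -> M) (C : 'M[R]_(s, r)) :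
  (forall v, exists c : 'cV[R]_r, v = \sum_(i < r) c i ord0 *: e i) ->
  (forall c : 'cV[R]_r, \sum_(i < r) c i ord0 *: e i = 0 <->
     exists x : 'cV[R]_s, c = N *m x) ->
  N = N *m C *m N -> flat_module M.
Proof.
move=> gen rel NCN.
have {gen}[c cP] := choice gen.
pose p (x : 'cV[R]_r) := x - N *m (C *m x).
have pN (x : 'cV[R]_s) : p (N *m x) = 0 by rewrite /p !mulmxA -NCN subrr.
have cong (c1 c2 : 'cV[R]_r) :
    \sum_(i < r) c1 i ord0 *: e i = \sum_(i < r) c2 i ord0 *: e i -> p c1 = p c2.
  move=> h; have [|x xE] := (rel (c1 - c2)).1.
    by under eq_bigr => i _ do rewrite !mxE scalerBl; rewrite sumrB h subrr.
  apply/eqP; rewrite -subr_eq0; apply/eqP.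
  by rewrite -(pN x) -xE /p !mulmxBr opprB !opprD !addrA opprK addrAC [RHS]addrAC
     -!addrA; congr (_ + _); rewrite addrC addrA.
apply: (@flat_dual_basis _ _ _ e (fun v i => p (c v) i ord0)) => [i a u v|v].
  have -> : p (c (a *: u + v)) = p (a *: c u + c v).
    apply: cong; rewrite -cP {1}[u]cP {1}[v]cP scaler_sumr -big_split /=.
    by apply: eq_bigr => j _; rewrite !mxE scalerDl scalerA.
  have -> : p (a *: c u + c v) = a *: p (c u) + p (c v).
    by rewrite /p !mulmxDr -!scalemxAr scalerBr opprD addrACA.
  by rewrite !mxE.
(* The coordinates [c v] and their projections differ by N C (c v), which is a relation. *)
rewrite {1}[v]cP; apply/eqP; rewrite -subr_eq0 -sumrB; apply/eqP.
rewrite -[RHS]((rel (N *m (C *m c v))).2); last by exists (C *m c v).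
apply: eq_bigr => i _; rewrite -scalerBl; congr (_ *: _).
by rewrite mxE [X in _ - (_ + X)]mxE opprD opprK addrA subrr add0r.
Qed.

End RegularMatrix.

(** * Minors *)

(** [minors] ranges over increasing index maps only; sorting the image of an injective map leaves a
    permutation, which merely changes the sign of a determinant. *)
Lemma injective_sort (j r : nat) (f : 'I_j -> 'I_r) : injective f ->
  exists (f' : 'I_j -> 'I_r) (s : 'S_j),
    {homo f' : x y / (x < y)%N} /\ forall i, f i = f' (s i).
Proof.
move=> injf; set A := [set f i | i : 'I_j]%SET.
have cardA : #|A| = j by rewrite card_imset ?card_ord.
pose f' (i : 'I_j) : 'I_r := enum_val (cast_ord (esym cardA) i).
have fA i : f i \in A by apply: imset_f.
pose s0 i := cast_ord cardA (enum_rank_in (fA i) (f i)).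
have s0K i : f' (s0 i) = f i by rewrite /f' /s0 cast_ordK enum_rankK_in.
have injs : injective s0 by move=> x y h; apply: injf; rewrite -!s0K h.
exists f', (perm injs); split=> [x y xy|i]; last by rewrite permE s0K.
have sorted_enum : sorted (fun a b : 'I_r => (a < b)%N) (enum A).
  rewrite {1}/enum_mem; apply: sorted_filter => [a b c|]; first exact: ltn_trans.
  have : sorted ltn (map val (enum 'I_r)) by rewrite val_enum_ord iota_ltn_sorted.
  by rewrite sorted_map enumT.
rewrite /f' !(enum_val_nth (f x)).
apply: (sorted_ltn_nth _ _ sorted_enum) => //; first exact: ltn_trans.
  by rewrite inE -cardE ltn_ord.
by rewrite inE -cardE ltn_ord.
Qed.

Section Minors.
Variables (R : comNzRingType) (r s : nat) (N : 'M[R]_(r, s)).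

(** A repeated row or column makes the determinant vanish; otherwise it is a minor up to sign. *)
Lemma ideal_minor (K : ideal R) (j : nat) : (forall d, minors N j d -> K d) ->
  forall (f : 'I_j -> 'I_r) (g : 'I_j -> 'I_s), K (\det (mxsub f g N)).
Proof.
move=> minK f g.
have [injf|] := pselect (injective f); last first.
  move=> ninj; suff -> : \det (mxsub f g N) = 0 by apply: ideal0.
  have [x [y [xy fxy]]] : exists x y, x != y /\ f x = f y.
    apply: contrapT => h; apply: ninj => x y fxy.
    by apply: contrapT => /eqP xy; apply: h; exists x, y.
  by apply: (determinant_alternate xy) => i; rewrite !mxE fxy.
have [injg|] := pselect (injective g); last first.
  move=> ninj; suff -> : \det (mxsub f g N) = 0 by apply: ideal0.
  have [x [y [xy gxy]]] : exists x y, x != y /\ g x = g y.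
    apply: contrapT => h; apply: ninj => x y gxy.
    by apply: contrapT => /eqP xy; apply: h; exists x, y.
  rewrite -det_tr.
  by apply: (determinant_alternate xy) => i; rewrite !mxE gxy.
have [f' [t [homf fE]]] := injective_sort injf.
have [g' [u [homg gE]]] := injective_sort injg.
have -> : mxsub f g N = row_perm t (col_perm u (mxsub f' g' N)).
  by apply/matrixP=> a b; rewrite !mxE fE gE.
rewrite row_permE col_permE !det_mulmx !det_perm mulrCA.
by rewrite mulrC; apply: idealM; apply: minK; exists f', g'.
Qed.

End Minors.

Definition ord_cons (q r : nat) (p : 'I_r) (f : 'I_q -> 'I_r) (i : 'I_(1 + q)) : 'I_r :=
  match split i with inl _ => p | inr j => f j end.

Section Schur.
Variables (R : comPzRingType) (r s q : nat) (N : 'M[R]_(r, s)).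
Variables (f : 'I_q -> 'I_r) (g : 'I_q -> 'I_s).

(** With A = [mxsub f g N], this is det A times the Schur complement of A, written with the adjugate
    so as to avoid inverting A. It keeps all r rows and s columns. *)
Definition schur : 'M[R]_(r, s) :=
  \det (mxsub f g N) *: N - colsub g N *m \adj (mxsub f g N) *m rowsub f N.

(** Right multiplication by [S], of determinant det A, makes the bordered matrix block triangular
    with diagonal blocks [schur p t] and A. The factor det A is kept on both sides, as it may be a
    zero divisor. *)
Lemma det_bordered p t :
  \det (mxsub (ord_cons p f) (ord_cons t g) N) * \det (mxsub f g N) =
  schur p t * \det (mxsub f g N).
Proof.
set A := mxsub f g N.
pose b := mxsub f (fun _ : 'I_1 => t) N.
pose c := mxsub (fun _ : 'I_1 => p) g N.
pose d : 'M[R]_1 := (N p t)%:M.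
have -> : mxsub (ord_cons p f) (ord_cons t g) N = block_mx d c b A.
  rewrite -[LHS]submxK; congr block_mx; apply/matrixP=> i j;
    rewrite !mxE /ord_cons ?(unsplitK (inl _)) ?(unsplitK (inr _)) //.
  by rewrite !ord1 eqxx.
pose S := block_mx (\det A)%:M 0 (- (\adj A *m b)) (1%:M : 'M_q).
have detS : \det S = \det A by rewrite det_lblock det_scalar1 det1 mulr1.
rewrite -{1}detS -det_mulmx mulmx_block !mulmxN !mulmxA mul_mx_adj.
rewrite !mulmx1 !mulmx0 !add0r !mul_mx_scalar mul_scalar_mx subrr det_ublock.
congr (_ * _); rewrite det_mx11 !mxE eqxx mulr1n; congr (_ - _).
apply: eq_bigr => i _; rewrite !mxE; congr (_ * _).
by apply: eq_bigr => j _; rewrite !mxE.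
Qed.

End Schur.

(** The product factors through R^q. Padding by a zero column and a zero row makes both factors
    square, and the first one then has determinant 0. *)
Lemma det_mul_narrow (R : comPzRingType) (q : nat)
    (A : 'M[R]_(1 + q, q)) (B : 'M[R]_(q, 1 + q)) : \det (A *m B) = 0.
Proof.
have -> : A *m B = row_mx (0 : 'cV_(1 + q)) A *m col_mx (0 : 'rV_(1 + q)) B.
  by rewrite mul_row_col mul0mx add0r.
have -> : row_mx 0 A = block_mx 0 (usubmx A) (0 : 'cV_q) (dsubmx A).
  by rewrite block_mxEh col_mx0 vsubmxK.
by rewrite det_mulmx det_ublock det_mx11 mxE !mul0r.
Qed.

Section RegularMinors.
Variables (R : idomainType) (r s q : nat) (N : 'M[R]_(r, s)) (J : ideal R).
Variables (f : 'I_q -> 'I_r) (g : 'I_q -> 'I_s).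
Let D := \det (mxsub f g N).

Lemma schur_ideal (K : ideal R) : (forall d, minors N (1 + q) d -> K d) ->
  forall p t, K (D * schur N f g p t).
Proof.
by move=> minK p t; rewrite mulrC -det_bordered mulrC; apply/idealM/ideal_minor.
Qed.

(** Placing the adjugate at rows [g] and columns [f] gives a matrix E for which N E N is the term
    subtracted in [schur]. Hence D^2 N - N (D E) N = D [schur], whose entries lie in J. *)
Lemma regular_of_minors : (forall d, minors N (1 + q) d -> J d) ->
  exists C : 'M[R]_(s, r), forall p t, J (D ^+ 2 * N p t - (N *m C *m N) p t).
Proof.
move=> minJ; pose E := colsub g 1%:M *m \adj (mxsub f g N) *m rowsub f 1%:M.
exists (D *: E) => p t.
have -> : N *m (D *: E) *m N = D *: (colsub g N *m \adj (mxsub f g N) *m rowsub f N).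
  rewrite -scalemxAr -scalemxAl /E !mulmxA mulmx_colsub mulmx1 -!mulmxA.
  by rewrite mul_rowsub_mx mul1mx.
have := schur_ideal minJ p t; rewrite /schur -/D; congr ideal_fun.
by rewrite mxE [X in D * (_ + X)]mxE [(D *: N) p t]mxE mulrBr mulrA -expr2
  [X in _ = _ - X]mxE.
Qed.

(* With X the Schur complement, (delta D - X C) X = 0 modulo J, so that
   det (delta D - X C), which is (delta D)^r modulo P, kills X. *)
Lemma minors_of_regular (P : Spec R) (C : 'M[R]_(s, r)) (delta : R) :
  (forall x, J x -> P x) -> ~ P delta -> ~ P D ->
  (forall d, minors N (1 + q) d -> P d) ->
  (forall p t, J (delta * N p t - (N *m C *m N) p t)) ->
  exists2 b, ~ P b & forall d, minors N (1 + q) d -> J (b * d).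
Proof.
move=> JP Pdelta PD minP NCN.
pose X := schur N f g; pose A := mxsub f g N.
have XP p t : P (X p t) by have := schur_ideal minP p t => /spec_prime[].
pose pi := quot_pi J.
pose b0 := \det ((delta * D)%:M - X *m C).
(* The entries of X lie in P, so modulo P the determinant [b0] is (delta D)^r. *)
have Pb0 : ~ P b0.
  have /eqP/quot_piP b0E : quot_pi P b0 = quot_pi P ((delta * D) ^+ r).
    rewrite -[LHS]det_map_mx map_mxB map_mxM map_scalar_mx.
    have -> : map_mx (quot_pi P) X = 0.
      apply/matrixP=> i j; rewrite mxE [RHS]mxE -[RHS](rmorph0 (quot_pi P)).
      by apply/eqP/quot_piP; rewrite subr0; apply: XP.
    by rewrite mul0mx subr0 det_scalar rmorphXn.
  have : ~ P ((delta * D) ^+ r) by apply/spec_notX/spec_notM.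
  by apply: contra_not => Pb0; rewrite -(subKr b0 (_ ^+ r)); apply: idealB.
(* In R / J one has x = L n = n G, and x G = d x because x vanishes on the columns [g]. So x c x = L
   (n c n) G = e (L n) G = e d x, and the adjugate of e d - x c yields the claim. *)
have b0X p t : J (b0 * X p t).
  pose n := map_mx pi N; pose c := map_mx pi C; pose x := map_mx pi X.
  pose d := pi D; pose e := pi delta; pose a := map_mx pi A.
  have da : d = \det a by rewrite det_map_mx.
  have nE : e *: n = n *m c *m n.
    apply/matrixP=> i j; rewrite -!map_mxM -map_mxZ !mxE.
    by apply/eqP/quot_piP; have := NCN i j; rewrite !mxE.
  pose U := colsub g n; pose V := rowsub f n.
  have xE : x = d *: n - U *m \adj a *m V.
    rewrite /x /X /schur map_mxB map_mxZ !map_mxM map_mx_adj -/A -/a -/D -/d.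
    by rewrite !map_mxsub -/n -/U -/V.
  pose L : 'M_r := d%:M - U *m \adj a *m rowsub f 1%:M.
  pose G : 'M_s := d%:M - colsub g 1%:M *m \adj a *m V.
  have xL : x = L *m n.
    by rewrite /L mulmxBl mul_scalar_mx -(mulmxA _ (rowsub _ _)) mul_rowsub_mx mul1mx.
  have xG : x = n *m G.
    by rewrite xE mulmxBr mul_mx_scalar !mulmxA mulmx_colsub mulmx1.
  have x_g : x *m colsub g 1%:M = 0.
    have Vg : V *m colsub g 1%:M = a.
      by rewrite mulmx_colsub mulmx1; apply/matrixP=> i j; rewrite !mxE.
    rewrite xE mulmxBl -scalemxAl -(mulmxA _ V) Vg -mulmxA mul_adj_mx -da.
    by rewrite mulmx_colsub mulmx1 mul_mx_scalar subrr.
  have xGE : x *m G = d *: x.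
    by rewrite mulmxBr !mulmxA x_g !mul0mx subr0 mul_mx_scalar.
  have key : ((e * d)%:M - x *m c) *m x = 0.
    have xcx : x *m c *m x = (e * d) *: x.
      transitivity (L *m (n *m c *m n) *m G); first by rewrite {1}xL xG !mulmxA.
      by rewrite -nE -scalemxAr -scalemxAl -xL xGE scalerA.
    by rewrite mulmxBl mul_scalar_mx xcx subrr.
  have : \det ((e * d)%:M - x *m c) *: x = 0.
    by rewrite -mul_scalar_mx -mul_adj_mx -mulmxA key mulmx0.
  move=> /matrixP/(_ p t); rewrite !mxE => h.
  rewrite -[_ * _]subr0; apply/quot_piP; apply/eqP.
  rewrite rmorph0 rmorphM -h; congr (_ * _).
  by rewrite -det_map_mx map_mxB map_mxM map_scalar_mx rmorphM.
(* Modulo J, b0 D N = W N_f factors through R^q, so the (1 + q)-minors of b0 D N vanish; each row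
   contributes one factor b0 D. *)
exists ((b0 * D) ^+ (1 + q)); first by apply/spec_notX/spec_notM.
pose W := b0 *: (colsub g N *m \adj A).
have narrow : map_mx pi ((b0 * D) *: N) = map_mx pi (W *m rowsub f N).
  apply/matrixP=> i j; rewrite mxE [RHS]mxE; apply/eqP/quot_piP.
  have := b0X i j; congr ideal_fun.
  rewrite /X /schur -/D -/A /W -scalemxAl [in LHS]mxE [(D *: N) i j]mxE.
  rewrite [X in b0 * (_ + X)]mxE mulrBr mulrA [X in _ = X - _]mxE.
  by rewrite [X in _ = _ - X]mxE.
move=> _ [f1 [g1 [_ _ ->]]]; rewrite -detZ -[\det _]subr0.
have -> : (b0 * D) *: mxsub f1 g1 N = mxsub f1 g1 ((b0 * D) *: N).
  by apply/matrixP=> i j; rewrite !mxE.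
apply/quot_piP; rewrite rmorph0 -det_map_mx map_mxsub narrow -map_mxsub.
by rewrite mxsub_mul map_mxM det_mul_narrow.
Qed.

End RegularMinors.

(** * Monomial orders *)

(** Each next index is a place where the minimum of the remaining tail is attained. *)
Lemma nondecreasing_subseq (a : nat -> nat) : exists phi : nat -> nat,
  (forall i, (phi i < phi i.+1)%N) /\ (forall i, (a (phi i) <= a (phi i.+1))%N).
Proof.
have minP k : exists j, (k <= j)%N /\ forall l, (k <= l)%N -> (a j <= a l)%N.
  have ex : exists v, `[< exists j, (k <= j)%N /\ a j = v >].
    by exists (a k); apply/asboolP; exists k.
  case: (ex_minnP ex) => v /asboolP[j [kj ajv]] minv; exists j; split=> // l kl.
  by rewrite ajv; apply: minv; apply/asboolP; exists l.
have [h hP] := choice minP.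
pose phi := fix phi i := if i is i'.+1 then h (phi i').+1 else h 0%N.
have phi_min i l : (phi i <= l)%N -> (a (phi i) <= a l)%N.
  case: i => [|i] /= lel; apply: (hP _).2 => //.
  by apply: leq_trans lel; apply: (hP _).1.
exists phi; split=> i /=; first exact: (hP _).1.
by apply: phi_min; apply/ltnW; apply: (hP _).1.
Qed.

(** Dickson's lemma: subsequences are extracted one coordinate at a time, and a subsequence of a
    nondecreasing sequence stays nondecreasing in the coordinates already treated. *)
Lemma dickson n (u : nat -> 'X_{1..n}) : exists i j, (i < j)%N /\ (u i <= u j)%MM.
Proof.
suff /(_ n (leqnn n)) [phi [incr mono]] : forall k, (k <= n)%N ->
    exists phi : nat -> nat, (forall i, (phi i < phi i.+1)%N) /\
      forall (l : 'I_n), (l < k)%N ->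
      forall i, (u (phi i) l <= u (phi i.+1) l)%N.
  exists (phi 0%N), (phi 1%N); split=> //.
  by apply/mnm_lepP => l; apply: mono.
elim=> [|k IHk] ltkn; first by exists id; split.
have [phi [incr mono]] := IHk (ltnW ltkn).
have [psi [psi_incr psi_mono]] :=
  nondecreasing_subseq (fun i => u (phi i) (Ordinal ltkn)).
exists (phi \o psi); split=> [i|l] /=; first exact: (homo_ltn ltn_trans incr).
rewrite ltnS leq_eqVlt => /predU1P[lk|lk] i.
  by have -> : l = Ordinal ltkn by apply: val_inj.
apply: (homo_leq (f := fun i => u (phi i) l) leqnn leq_trans).
  by move=> j; apply: mono.
exact: ltnW.
Qed.

Lemma not_wf_seq (X : Type) (lt : X -> X -> Prop) :
  ~ well_founded lt -> exists u : nat -> X, forall i, lt (u i.+1) (u i).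
Proof.
move=> nwf; have [x0 nx0] : exists x, ~ Acc lt x.
  by apply: contrapT => h; apply: nwf => x; apply: contrapT => nx; apply: h; exists x.
have next (x : {x | ~ Acc lt x}) : exists y : {x | ~ Acc lt x}, lt (sval y) (sval x).
  case: x => x nx /=; apply: contrapT => h; apply: nx; constructor=> y yx.
  by apply: contrapT => ny; apply: h; exists (exist _ y ny).
have [f fP] := choice next.
exists (fun i => sval (iter i f (exist _ x0 nx0))) => i.
exact: fP.
Qed.

Lemma mcoeffXM (R : comNzRingType) n (g v : 'X_{1..n}) (p : {mpoly R[n]}) :
  ('X_[g] * p)@_(g + v) = p@_v.
Proof. by rewrite mulrC mcoeffMX. Qed.

Section MonomialOrder.
Variables (n : nat) (T : rel 'X_{1..n}).
Hypothesis ordT : monomial_order T.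

Definition strict_order : 'X_{1..n} -> 'X_{1..n} -> Prop := fun u v => T u v /\ u <> v.

Let totT : total T. Proof. by case: ordT. Qed.
Let antiT : antisymmetric T. Proof. by case: ordT. Qed.
Let transT : transitive T. Proof. by case: ordT. Qed.
Let minT u : T 0%MM u. Proof. by case: ordT. Qed.
Let addT u v w : T u v -> T (u + w)%MM (v + w)%MM. Proof. by case: ordT => *; auto. Qed.

Lemma order_anti u v : T u v -> T v u -> u = v.
Proof. by move=> uv vu; apply: antiT; rewrite uv. Qed.

Lemma order_refl u : T u u. Proof. by have := totT u u; rewrite orbb. Qed.

Lemma order_le0 u : T u 0%MM -> u = 0%MM.
Proof. by move=> u0; apply: order_anti. Qed.

Lemma order_dvd u v : (u <= v)%MM -> T u v.
Proof. by move=> uv; rewrite -(submK uv) -{1}[u]add0m; apply: addT. Qed.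

Lemma strict_orderD u v w : strict_order u v -> strict_order (u + w)%MM (v + w)%MM.
Proof. by move=> [uv neq]; split; [apply: addT | move/addIm]. Qed.

(** In an infinite descending sequence an earlier monomial would divide a later one by [dickson],
    hence be at most the later one. *)
Lemma strict_order_wf : well_founded strict_order.
Proof.
apply: contrapT => /not_wf_seq[u uP].
have desc i j : (i < j)%N -> strict_order (u j) (u i).
  elim: j => // j IHj; rewrite ltnS leq_eqVlt => /predU1P[->|ij]; first exact: uP.
  have [h1 _] := uP j; have [h2 h3] := IHj ij; split; first exact: transT h2.
  by move=> eqji; apply: h3; apply: order_anti => //; rewrite -eqji.
have [i [j [ij dvdij]]] := dickson u.
by have [h] := desc _ _ ij; apply; apply: order_anti => //; apply: order_dvd.
Qed.

Section LeadingMonomial.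
Variable R : nzRingType.
Implicit Type p : {mpoly R[n]}.

Lemma lm_mem_max p : p != 0 ->
  lm T p \in msupp p /\ forall u, u \in msupp p -> T u (lm T p).
Proof.
rewrite -msupp_eq0 /lm; elim: (msupp p) => // v s IHs _.
rewrite big_cons; set b := \big[_/_]_(_ <- _) _ in IHs *.
(* The fold starts at the monomial 0, the least one, so on a singleton both branches return [v]. *)
have [s0|s0] := eqVneq s [::].
  move: IHs; rewrite /b s0 big_nil => _; case: ifP => [v0|_].
    by rewrite (order_le0 v0); split; rewrite ?inE // => w; rewrite inE => /eqP->.
  by split; rewrite ?inE // => w; rewrite inE => /eqP->; apply: order_refl.
have {IHs s0}[bs maxb] := IHs s0.
case: ifP => [vb|nvb].
  split; first by rewrite inE bs orbT.
  by move=> w; rewrite inE => /predU1P[->|/maxb].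
have {nvb}bv : T b v by have := totT v b; rewrite nvb.
split; first by rewrite inE eqxx.
move=> w; rewrite inE => /predU1P[->|/maxb wb]; first exact: order_refl.
exact: transT bv.
Qed.

Lemma lm_mem p : p != 0 -> lm T p \in msupp p.
Proof. by move/lm_mem_max => []. Qed.

Lemma lm_max p u : u \in msupp p -> T u (lm T p).
Proof.
have [-> |/lm_mem_max[_]] := eqVneq p 0; last by apply.
by rewrite msupp0.
Qed.

End LeadingMonomial.

(** The division algorithm as an induction principle: a reduction step cancels the leading term, and
    the order is well-founded. The invariant [Q] has to be stable for every scalar [c]; the one used
    is the quotient of the leading coefficients. *)
Lemma groebner_ind (k : fieldType) (I : ideal {mpoly k[n]}) (G : seq {mpoly k[n]})
    (Q : {mpoly k[n]} -> Prop) :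
  groebner_basis T I G -> Q 0 ->
  (forall f g c, I f -> f != 0 -> g \in G -> g != 0 -> (lm T g <= lm T f)%MM ->
     Q (f - (c *: 'X_[lm T f - lm T g]) * g) -> Q f) ->
  forall f, I f -> Q f.
Proof.
move=> [GI Gdiv] Q0 QS f; move: {2}(lm T f) (erefl (lm T f)) => u.
elim/(well_founded_ind strict_order_wf): u f => u IHu f lmf If.
have [->//|f0] := eqVneq f 0.
have [g [gG g0 dvd]] := Gdiv f If f0.
pose gam := (lm T f - lm T g)%MM.
have gamE : (gam + lm T g)%MM = lm T f by rewrite submK.
have lmg0 : g@_(lm T g) != 0 by rewrite -mcoeff_msupp lm_mem.
pose c := f@_(lm T f) / g@_(lm T g).
apply: (QS f g c) => //; rewrite -/gam.
set f' := f - _; have [->//|f'0] := eqVneq f' 0.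
apply: (IHu (lm T f')) => //; last by apply: idealB => //; apply/idealM/GI.
rewrite -lmf; split; last first.
  move=> lmE; have := lm_mem f'0; rewrite lmE mcoeff_msupp mcoeffB -scalerAl.
  by rewrite mcoeffZ -[X in _ - _ * _@_X]gamE mcoeffXM divfK // subrr eqxx.
have /msuppB_le := lm_mem f'0; rewrite mem_cat => /orP[|]; first exact: lm_max.
rewrite -scalerAl => /msuppZ_le; rewrite mulrC (perm_mem (msuppMX _ _)).
move=> /mapP[v vg ->]; rewrite -gamE ![(gam + _)%MM]addmC.
exact/addT/lm_max.
Qed.

End MonomialOrder.

(** An order on one block cannot separate monomials that differ elsewhere. Block orders are
    therefore assembled from preorders, and antisymmetry is recovered once the blocks exhaust the
    variables. *)
Definition monomial_preorder n (T : rel 'X_{1..n}) : Prop :=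
  [/\ total T, transitive T, forall u, T 0%MM u &
      forall u v w, T u v -> T (u + w)%MM (v + w)%MM].

Lemma monomial_orderP n (T : rel 'X_{1..n}) :
  monomial_order T <-> monomial_preorder T /\ antisymmetric T.
Proof. by split=> [[tot anti tr min0 add]|[[tot tr min0 add] anti]]; split. Qed.

Section BlockOrder.
Variables (a N : nat) (f : 'I_a -> 'I_N).

Lemma mrestr0 : mrestr f 0%MM = 0%MM.
Proof. by apply/mnmP => i; rewrite mnmE !mnm0E. Qed.

Lemma mrestrD u v : mrestr f (u + v)%MM = (mrestr f u + mrestr f v)%MM.
Proof. by apply/mnmP => i; rewrite !(mnmE, mnmDE). Qed.

Lemma mrestrB u v : mrestr f (u - v)%MM = (mrestr f u - mrestr f v)%MM.
Proof. by apply/mnmP => i; rewrite !(mnmE, mnmBE). Qed.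

Lemma mrestr_dvd u v : (u <= v)%MM -> (mrestr f u <= mrestr f v)%MM.
Proof. by move=> /mnm_lepP uv; apply/mnm_lepP => i; rewrite !mnmE. Qed.

Variables (T : rel 'X_{1..a}) (T' : rel 'X_{1..N}).
Hypothesis ordT : monomial_order T.

Lemma order_on_preorder : monomial_preorder (order_on f T).
Proof.
case: ordT => tot anti tr min0 add; rewrite /order_on; split.
- by move=> u v; apply: tot.
- by move=> v u w; apply: tr.
- by move=> u; rewrite mrestr0.
- by move=> u v w uv; rewrite !mrestrD; apply: add.
Qed.

Lemma block_preorder : monomial_preorder T' -> monomial_preorder (block_order f T T').
Proof.
case: ordT => tot anti tr min0 add [tot' tr' min0' add']; rewrite /block_order; split.
- by move=> u v; rewrite (eq_sym (mrestr f v)); case: ifP => // _; apply: tot.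
- move=> v u w; case: (eqVneq (mrestr f u) (mrestr f v)) => [->|uv].
    by case: ifP => // _; apply: tr'.
  case: (eqVneq (mrestr f v) (mrestr f w)) => [<-|vw h1 h2].
    by rewrite (negPf uv).
  case: eqVneq => [uw|_]; last exact: tr h2.
  by case/eqP: uv; apply: anti; rewrite h1 uw h2.
- by move=> u; rewrite mrestr0; case: ifP.
- move=> u v w; rewrite !mrestrD eqm_add2r; case: ifP => _; first exact: add'.
  exact: add.
Qed.

Lemma block_order_le u v : block_order f T T' u v -> T (mrestr f u) (mrestr f v).
Proof.
by rewrite /block_order; case: eqVneq => [->|//]; rewrite order_refl.
Qed.

Lemma block_order_anti u v : block_order f T T' u v -> block_order f T T' v u ->
  mrestr f u = mrestr f v /\ T' u v /\ T' v u.
Proof.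
move=> uv vu; have := order_anti ordT (block_order_le uv) (block_order_le vu).
by move=> e; move: uv vu; rewrite /block_order e eqxx.
Qed.

End BlockOrder.

(** * Polynomial rings over polynomial rings *)

Lemma mpoly_rmorph_eq (k : comNzRingType) (N : nat) (S : pzSemiRingType)
    (phi psi : {rmorphism {mpoly k[N]} -> S}) :
  (forall c, phi c%:MP = psi c%:MP) -> (forall i, phi 'X_i = psi 'X_i) -> phi =1 psi.
Proof.
move=> hC hX p; rewrite [p]mpolyE !rmorph_sum; apply: eq_bigr => u _.
rewrite -mul_mpolyC !rmorphM hC mpolyXE_id !rmorph_prod; congr (_ * _).
by apply: eq_bigr => i _; rewrite !rmorphXn hX.
Qed.

Section Rename.
Variables (k : comNzRingType) (a N : nat) (f : 'I_a -> 'I_N).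

Definition mpush (u : 'X_{1..a}) : 'X_{1..N} := (\sum_(i < a) U_(f i) *+ u i)%MM.

Lemma renameC (c : k) : rename f c%:MP = c%:MP.
Proof. exact: comp_mpolyC. Qed.

Lemma renameXi i : rename f ('X_i : {mpoly k[a]}) = 'X_(f i).
Proof. by rewrite /rename comp_mpolyXU -tnth_nth tnth_mktuple. Qed.

Lemma renameX u : rename f ('X_[u] : {mpoly k[a]}) = 'X_[mpush u].
Proof.
rewrite mpolyXE_id rmorph_prod (big_morph _ (@mpolyXD _ _) (mpolyX0 _ _)).
apply: eq_bigr => i _.
by rewrite rmorphXn /= renameXi mpolyXn.
Qed.

Lemma renameZ c (p : {mpoly k[a]}) : rename f (c *: p) = c *: rename f p.
Proof. by rewrite -!mul_mpolyC rmorphM /= renameC. Qed.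

Lemma mpush_out u i : (forall j, f j != i) -> mpush u i = 0%N.
Proof.
move=> fi; rewrite /mpush mnm_sumE big1 // => j _.
by rewrite mulmnE mnm1E (negPf (fi j)) mul0n.
Qed.

Lemma mpush_in u i : injective f -> mpush u (f i) = u i.
Proof.
move=> injf; rewrite /mpush mnm_sumE (bigD1 i) //= big1 => [|j ji].
  by rewrite mulmnE mnm1E eqxx mul1n addn0.
by rewrite mulmnE mnm1E (inj_eq injf) (negPf ji) mul0n.
Qed.

End Rename.

Section PolyInX.
Variables (k : fieldType) (m n : nat).
Local Notation Y := {mpoly k[m]}.
Local Notation R0 := {mpoly k[m + n]}.
Local Notation ypart := (mrestr (@lshift m n)).
Local Notation xpart := (mrestr (@rshift m n)).

Definition incl_x : {mpoly k[n]} -> R0 := rename (@rshift m n).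
HB.instance Definition _ := GRing.RMorphism.copy incl_x (rename (@rshift m n)).

HB.instance Definition _ := GRing.RMorphism.copy (@poly_in_x k m n)
  (mmap (@mpolyC n Y \o @mpolyC m k)
    (fun i : 'I_(m + n) => match split i with inl j => ('X_j)%:MP | inr j => 'X_j end)).

Lemma poly_in_xC c : poly_in_x (c%:MP : R0) = c%:MP%:MP.
Proof. exact: mmapC. Qed.

Lemma poly_in_x_y i : poly_in_x ('X_(lshift n i) : R0) = ('X_i)%:MP.
Proof. by rewrite /poly_in_x mmapX mmap1U (unsplitK (inl _)). Qed.

Lemma poly_in_x_x i : poly_in_x ('X_(rshift m i) : R0) = 'X_i.
Proof. by rewrite /poly_in_x mmapX mmap1U (unsplitK (inr _)). Qed.

Lemma poly_in_x_incl_y (q : Y) : poly_in_x (incl_y k m n q) = q%:MP.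
Proof.
pose phi : {rmorphism Y -> {mpoly Y[n]}} := @poly_in_x k m n \o incl_y k m n.
apply: (mpoly_rmorph_eq (phi := phi) (psi := @mpolyC n Y)).
  by move=> c /=; rewrite /incl_y renameC poly_in_xC.
by move=> i /=; rewrite /incl_y renameXi poly_in_x_y.
Qed.

Lemma poly_in_x_incl_x (u : 'X_{1..n}) : poly_in_x (incl_x 'X_[u]) = 'X_[u].
Proof.
rewrite mpolyXE_id [in RHS]mpolyXE_id !rmorph_prod; apply: eq_bigr => i _.
by rewrite !rmorphXn /= /incl_x renameXi poly_in_x_x.
Qed.

Lemma poly_in_xX (w : 'X_{1..m + n}) :
  poly_in_x ('X_[w] : R0) = ('X_[ypart w])%:MP * 'X_[xpart w].
Proof.
rewrite mpolyXE_id !rmorph_prod big_split_ord /=; congr (_ * _).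
  rewrite [in RHS]mpolyXE_id rmorph_prod; apply: eq_bigr => i _.
  by rewrite !rmorphXn /= poly_in_x_y mnmE.
rewrite [in RHS]mpolyXE_id; apply: eq_bigr => i _.
by rewrite !rmorphXn /= poly_in_x_x mnmE.
Qed.

Lemma mnm_split_eq (w w' : 'X_{1..m + n}) :
  ypart w = ypart w' -> xpart w = xpart w' -> w = w'.
Proof.
move=> /mnmP hy /mnmP hx; apply/mnmP => i; case: (splitP i) => j ij.
  by have := hy j; rewrite !mnmE; have -> : lshift n j = i by apply: val_inj.
by have := hx j; rewrite !mnmE; have -> : rshift m j = i by apply: val_inj.
Qed.

Lemma mcoeff_poly_in_x (p : R0) (w : 'X_{1..m + n}) :
  (poly_in_x p)@_(xpart w)@_(ypart w) = p@_w.
Proof.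
rewrite [in LHS](mpolyE p) rmorph_sum !raddf_sum /= [in RHS](mpolyE p) raddf_sum.
apply: eq_bigr => v _; rewrite -!mul_mpolyC rmorphM /= poly_in_xC poly_in_xX.
rewrite mulrA -mpolyCM !mcoeffCM !mcoeffX.
case: (eqVneq v w) => [->|vw].
  by rewrite !eqxx mulr1 mcoeffCM mcoeffX eqxx.
case: (eqVneq (xpart v) (xpart w)) => [hx|_]; last by rewrite !mulr0 mcoeff0.
rewrite mulr1 mcoeffCM mcoeffX; case: eqVneq => // hy.
by case/eqP: vw; apply: mnm_split_eq.
Qed.

Lemma poly_in_x_inj : injective (@poly_in_x k m n).
Proof. by move=> p q pq; apply/mpolyP => w; rewrite -!mcoeff_poly_in_x pq. Qed.

Lemma poly_in_xE (p : R0) : p = \sum_(u <- msupp (poly_in_x p))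
  incl_y k m n (poly_in_x p)@_u * incl_x 'X_[u].
Proof.
apply: poly_in_x_inj; rewrite rmorph_sum {1}[poly_in_x p]mpolyE.
apply: eq_bigr => u _.
by rewrite rmorphM /= poly_in_x_incl_y poly_in_x_incl_x mul_mpolyC.
Qed.

Lemma msupp_poly_in_x (p : R0) (w : 'X_{1..m + n}) :
  w \in msupp p -> xpart w \in msupp (poly_in_x p).
Proof.
rewrite !mcoeff_msupp -mcoeff_poly_in_x; apply: contra_neq => ->.
by rewrite mcoeff0.
Qed.

(** The coefficient of x^u is a non-zero polynomial in y; any monomial y^v of it gives the monomial
    y^v x^u of [p]. *)
Lemma msupp_poly_in_xP (p : R0) (u : 'X_{1..n}) : u \in msupp (poly_in_x p) ->
  exists2 w, w \in msupp p & xpart w = u.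
Proof.
rewrite mcoeff_msupp -msupp_eq0; case E : (msupp _) => [//|v s] _.
have : v \in msupp (poly_in_x p)@_u by rewrite E inE eqxx.
pose w : 'X_{1..m + n} :=
  [multinom match split i with inl a => v a | inr b => u b end | i < m + n].
have wx : xpart w = u by apply/mnmP => i; rewrite !mnmE (unsplitK (inr _)).
have wy : ypart w = v by apply/mnmP => i; rewrite !mnmE (unsplitK (inl _)).
by rewrite mcoeff_msupp -wx -wy mcoeff_poly_in_x -mcoeff_msupp; exists w.
Qed.

(** * Leading coefficients of a Groebner basis over k[y] *)

Section Groebner.
Variables (Tx : rel 'X_{1..n}) (Ty : rel 'X_{1..m}).
Hypotheses (ordx : monomial_order Tx) (ordy : monomial_order Ty).

Lemma block_order_xy_monomial : monomial_order (block_order_xy Tx Ty).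
Proof.
apply/monomial_orderP; split.
  exact/(block_preorder _ ordx)/(order_on_preorder _ ordy).
move=> u v /andP[uv vu]; have [hx [hy1 hy2]] := block_order_anti ordx uv vu.
by apply: mnm_split_eq => //; apply: (order_anti ordy).
Qed.

(** The block order compares the x-parts first. *)
Lemma lm_poly_in_x (p : R0) : p != 0 ->
  lm Tx (poly_in_x p) = xpart (lm (block_order_xy Tx Ty) p).
Proof.
move=> p0; apply: (order_anti ordx).
  have q0 : poly_in_x p != 0.
    by apply: contra_neq p0 => p0; apply: poly_in_x_inj; rewrite p0 rmorph0.
  have [w wp <-] := msupp_poly_in_xP (lm_mem ordx q0).
  exact: (block_order_le ordx (lm_max block_order_xy_monomial wp)).
exact/(lm_max ordx)/msupp_poly_in_x/(lm_mem block_order_xy_monomial).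
Qed.

(** By division of f: since the coefficient at [al] is not in P, it is not 0 and the leading
    monomial has x-part [al]. Either the divisor g has its leading coefficient outside P, or the
    reduction changes the coefficient at [al] by an element of P and the argument repeats; f = 0 is
    never reached. *)
Lemma groebner_lc (I : ideal R0) (G : seq R0) (P : Spec Y) (al : 'X_{1..n}) (f : R0) :
  groebner_basis (block_order_xy Tx Ty) I G -> I f ->
  (forall u, u \in msupp (poly_in_x f) -> Tx u al) -> ~ P (poly_in_x f)@_al ->
  exists g, [/\ g \in G, g != 0, (lm Tx (poly_in_x g) <= al)%MM &
    ~ P (poly_in_x g)@_(lm Tx (poly_in_x g))].
Proof.
move=> GB If; pattern f; move: f If.
apply: (groebner_ind block_order_xy_monomial GB).
  by move=> _; rewrite rmorph0 mcoeff0 => /(_ (ideal0 P)).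
move=> f g c If f0 gG g0 dvd IH lef Pf.
have lmfx : xpart (lm (block_order_xy Tx Ty) f) = al.
  apply: (order_anti ordx).
    exact/lef/msupp_poly_in_x/(lm_mem block_order_xy_monomial).
  rewrite -lm_poly_in_x //; apply: (lm_max ordx).
  by rewrite mcoeff_msupp; apply: contra_notN Pf => /eqP->; apply: ideal0.
have lmg_al : (lm Tx (poly_in_x g) <= al)%MM.
  by rewrite lm_poly_in_x // -lmfx mrestr_dvd.
have [Pg|Pg] := pselect (P (poly_in_x g)@_(lm Tx (poly_in_x g))); last by exists g.
move: IH; set gam := (_ - _)%MM.
have gamx : (xpart gam + lm Tx (poly_in_x g))%MM = al.
  by rewrite /gam mrestrB lmfx -(lm_poly_in_x g0) (submK lmg_al).
pose q := (c *: 'X_[ypart gam] : Y).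
have -> : poly_in_x (f - (c *: 'X_[gam]) * g) =
    poly_in_x f - q *: ('X_[xpart gam] * poly_in_x g).
  rewrite rmorphB rmorphM -mul_mpolyC rmorphM /= poly_in_xC poly_in_xX /q.
  by rewrite -mul_mpolyC -mul_mpolyC mpolyCM !mulrA.
apply.
  move=> u /msuppB_le; rewrite mem_cat => /orP[/lef//|/msuppZ_le].
  rewrite mulrC (perm_mem (msuppMX _ _)) => /mapP[v vg ->].
  rewrite -gamx ![(xpart gam + _)%MM]addmC.
  by case: ordx => _ _ _ _; apply; apply: lm_max.
rewrite mcoeffB mcoeffZ -{2}gamx mcoeffXM => Pf'; apply: Pf.
rewrite -(subrK (q * (poly_in_x g)@_(lm Tx (poly_in_x g))) (_@_al)).
by apply: idealD => //; apply: idealM.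
Qed.

(** [groebner_lc] is applied to p(x_i), for p with leading coefficient outside P. It gives g whose
    leading monomial divides a power of x_i, hence is such a power. *)
Lemma groebner_pure_power (I : ideal R0) (G : seq R0) (P : Spec Y) (i : 'I_n) :
  groebner_basis (block_order_xy Tx Ty) I G ->
  (forall a, elim_ideal I a -> P a) -> ~ (lc_ideal I i `<=` P) ->
  exists2 g, g \in pure_power_basis Tx G i &
    ~ P (poly_in_x g)@_(lm Tx (poly_in_x g)).
Proof.
move=> GB JP nJi.
have [p [Ip Pp]] : exists p : {poly Y},
    I (map_poly (incl_y k m n) p).['X_(rshift m i)] /\ ~ P (lead_coef p).
  apply: contrapT => h; apply: nJi => _ [p Ip <-].
  by apply: contrapT => Pp; apply: h; exists p.
set f := _.[_] in Ip.
have fE : poly_in_x f = \sum_(j < size p) p`_j *: 'X_[U_(i) *+ j].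
  rewrite /f (@horner_coef_wide _ (size p)) ?size_poly // rmorph_sum; apply: eq_bigr => j _.
  rewrite coef_map rmorphM rmorphXn /= poly_in_x_incl_y poly_in_x_x mpolyXn.
  by rewrite mul_mpolyC.
have U_inj (j d : nat) : (U_(i) *+ j)%MM = (U_(i) *+ d)%MM -> j = d.
  by move/mnmP/(_ i); rewrite !mulmnE mnm1E eqxx !mul1n.
have [] := groebner_lc (al := (U_(i) *+ (size p).-1)%MM) (P := P) GB Ip.
- move=> u; rewrite fE => /msupp_sum_le /flattenP[_ /mapP[j _ ->]].
  move=> /msuppZ_le; rewrite msuppX inE => /eqP->; apply: order_dvd => //.
  apply/mnm_lepP => l; rewrite !mulmnE leq_mul2l -ltnS prednK ?ltn_ord ?orbT //.
  by apply: leq_ltn_trans (ltn_ord j).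
- rewrite fE raddf_sum /=; apply: contra_not Pp; congr (ideal_fun P).
  (* For p = 0 the degree [(size p).-1] is a default value, but both sides are 0. *)
  have [p0|p0] := posnP (size p).
    have /eqP -> : p == 0 by rewrite -size_poly_eq0 p0.
    by rewrite lead_coef0 size_poly0 big_ord0.
  have lt1 : ((size p).-1 < size p)%N by rewrite prednK.
  rewrite (bigD1 (Ordinal lt1)) //= big1 => [|j jp].
    by rewrite mcoeffZ mcoeffX eqxx mulr1 addr0.
  rewrite mcoeffZ mcoeffX; case: eqVneq => [/U_inj e|]; last by rewrite mulr0.
  by case/eqP: jp; apply: val_inj.
move=> g [gG g0 /mnm_lepP dvd Pg]; exists g => //.
set u := lm Tx (poly_in_x g) in dvd Pg *.
have uE : u = (U_(i) *+ u i)%MM.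
  apply/mnmP => l; have := dvd l; rewrite !mulmnE mnm1E.
  by case: eqVneq => [->|_]; rewrite ?mul1n ?mul0n // leqn0 => /eqP.
(* With exponent 0, g would be its own leading coefficient, an element of J and thus of P. *)
have ui : (0 < u i)%N.
  rewrite lt0n; apply/eqP => ui; apply: Pg; apply: JP.
  rewrite /elim_ideal /= /preimage /=.
  have u0 : u = 0%MM by rewrite uE ui mulm0n.
  suff <- : g = incl_y k m n (poly_in_x g)@_u by case: GB => + _; apply.
  apply: poly_in_x_inj; rewrite poly_in_x_incl_y.
  apply/mpolyP => v; rewrite mcoeffC u0; case: (eqVneq v 0%MM) => [->|v0].
    by rewrite mulr1.
  rewrite mulr0; apply/memN_msupp_eq0; apply: contra_neqN v0 => /(lm_max ordx).
  by rewrite -/u u0; apply: order_le0.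
rewrite /pure_power_basis mem_filter -/u ui -uE eqxx /= /basis_x mem_filter gG andbT.
(* If g involved only y, the exponent of x_i in its leading monomial would be 0. *)
apply/negP => /allP/(_ _ (lm_mem block_order_xy_monomial g0)) /forallP/(_ (rshift m i)).
rewrite /= ltnNge leq_addr /= => /eqP h.
by move: ui; rewrite /u lm_poly_in_x // mnmE h.
Qed.

End Groebner.
End PolyInX.

(** * Generators of a localised quotient ring as a module *)

Section Generated.
Variables (Y S : comPzRingType) (phi : {rmorphism Y -> S}) (I : ideal S).
Variables (r : nat) (e : 'I_r -> S) (a : Y).

(* The class of f in (S / I)_a lies in the span of the e_j over Y_a. *)
Definition generated (f : S) : Prop := exists l (c : 'I_r -> Y),
  I (phi (a ^+ l) * f - \sum_(j < r) phi (c j) * e j).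

Lemma generatedD f g : generated f -> generated g -> generated (f + g).
Proof.
move=> [l [c hf]] [l' [c' hg]].
exists (l + l')%N, (fun j => a ^+ l' * c j + a ^+ l * c' j).
have -> : phi (a ^+ (l + l')) * (f + g) -
    \sum_(j < r) phi (a ^+ l' * c j + a ^+ l * c' j) * e j =
    phi (a ^+ l') * (phi (a ^+ l) * f - \sum_(j < r) phi (c j) * e j) +
    phi (a ^+ l) * (phi (a ^+ l') * g - \sum_(j < r) phi (c' j) * e j).
  rewrite !mulrBr !mulr_sumr addrACA -opprD -big_split /= mulrDr.
  congr (_ + _ - _).
  - by rewrite exprD rmorphM mulrA (mulrC (phi (a ^+ l))).
  - by rewrite exprD rmorphM mulrA.
  - by apply: eq_bigr => j _; rewrite rmorphD !rmorphM mulrDl !mulrA.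
by apply: idealD; apply: idealM.
Qed.

Lemma generatedM y f : generated f -> generated (phi y * f).
Proof.
move=> [l [c hf]]; exists l, (fun j => y * c j).
have -> : phi (a ^+ l) * (phi y * f) - \sum_(j < r) phi (y * c j) * e j =
    phi y * (phi (a ^+ l) * f - \sum_(j < r) phi (c j) * e j).
  rewrite mulrBr mulrCA mulr_sumr; congr (_ - _).
  by apply: eq_bigr => j _; rewrite rmorphM mulrA.
exact: idealM.
Qed.

Lemma generated_sum (T : Type) (s : seq T) (P : pred T) (F : T -> S) :
  (forall i, P i -> generated (F i)) -> generated (\sum_(i <- s | P i) F i).
Proof.
move=> h; elim/big_ind: _ => //; last exact: generatedD.
exists 0%N, (fun=> 0); rewrite mulr0 sub0r big1 ?oppr0; first exact: ideal0.
by move=> j _; rewrite rmorph0 mul0r.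
Qed.

Lemma generated_congr f g : I (f - g) -> generated g -> generated f.
Proof.
move=> fg [l [c hg]]; exists l, c; rewrite -(subrK (phi (a ^+ l) * g) (_ * f)).
by rewrite -mulrBr -addrA; apply: idealD => //; apply: idealM.
Qed.

Lemma generated_cancel f : generated (phi a * f) -> generated f.
Proof. by move=> [l [c h]]; exists l.+1, c; rewrite exprSr rmorphM -mulrA. Qed.

Lemma generated_in j : generated (e j).
Proof.
exists 0%N, (fun i => (i == j)%:R); rewrite rmorph1 mul1r (bigD1 j) //= big1.
  by rewrite eqxx rmorph1 mul1r addr0 subrr; apply: ideal0.
by move=> i ij; rewrite (negPf ij) rmorph0 mul0r.
Qed.

End Generated.

Section MonomialGenerators.
Variables (k : fieldType) (m n : nat).
Local Notation Y := {mpoly k[m]}.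
Local Notation R0 := {mpoly k[m + n]}.
Variables (I : ideal R0) (Tx : rel 'X_{1..n}) (ordx : monomial_order Tx).
Variables (r : nat) (mon : r.-tuple 'X_{1..n}) (t : 'I_n -> nat) (a : Y).
Hypothesis mon_box : forall al : 'X_{1..n}, (forall i, (al i < t i)%N) -> al \in mon.
Hypothesis pure_power : forall i, exists g d, [/\ I g, (d <= t i)%N,
  lm Tx (poly_in_x g) = (U_(i) *+ d)%MM &
  exists b, a = b * (poly_in_x g)@_(U_(i) *+ d)].

(** Induction on x^al along [Tx]. Outside the box some x_i^d divides x^al, and a multiple of g
    rewrites (leading coefficient) x^al through smaller monomials; this suffices, as the leading
    coefficient divides a and [a] may be cancelled. *)
Lemma monomials_generate f :
  generated (incl_y k m n) I (fun j => incl_x m 'X_[tnth mon j]) a f.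
Proof.
suff gen_x al : generated (incl_y k m n) I (fun j => incl_x m 'X_[tnth mon j]) a
    (incl_x m 'X_[al]).
  by rewrite [f]poly_in_xE; apply: generated_sum => u _; apply: generatedM.
elim/(well_founded_ind (strict_order_wf ordx)): al => al IH.
have [box|/existsNP[i /negP]] := pselect (forall i, (al i < t i)%N).
  have /tnthP[j ->] := mon_box box; exact: (generated_in _ _ (fun j => _)).
rewrite -leqNgt => ti.
have [g [d [Ig dt lmg [b aE]]]] := pure_power i.
set u0 := (U_(i) *+ d)%MM in lmg aE; set lc := _@_u0 in aE.
have u0al : (u0 <= al)%MM.
  apply/mnm_lepP => l; rewrite mulmnE mnm1E.
  by case: eqVneq => [<-|_]; rewrite ?mul1n ?mul0n // (leq_trans dt ti).
apply: generated_cancel; rewrite {2}aE rmorphM -mulrA; apply: generatedM.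
set be := (al - u0)%MM; have beE : (be + u0)%MM = al by rewrite submK.
pose lower := \sum_(u <- msupp (poly_in_x g) | u != u0)
  incl_y k m n (poly_in_x g)@_u * incl_x m 'X_[be + u].
apply: (@generated_congr _ _ _ _ _ _ _ _ (incl_y k m n (- 1) * lower)).
  rewrite rmorphN1 mulN1r opprK.
  suff -> : incl_y k m n lc * incl_x m 'X_[al] + lower = incl_x m 'X_[be] * g.
    exact: idealM.
  have gE := congr1 ( *%R (incl_x m 'X_[be])) (poly_in_xE g).
  rewrite [RHS]gE [RHS]mulr_sumr; transitivity (\sum_(u <- msupp (poly_in_x g))
      incl_y k m n (poly_in_x g)@_u * incl_x m 'X_[be + u]).
    (* The leading monomial is missing from the support only for g = 0, and then [lc] is 0. *)
    have [u0g|u0g] := boolP (u0 \in msupp (poly_in_x g)).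
      by rewrite -[al in LHS]beE; apply/esym/(bigD1_seq u0 u0g (msupp_uniq _)).
    rewrite /lc (memN_msupp_eq0 u0g) rmorph0 mul0r add0r /lower.
    rewrite big_seq_cond [RHS]big_seq; apply: eq_bigl => u.
    by case: eqVneq => [->|_]; rewrite ?(negPf u0g) // andbT.
  by apply: eq_bigr => u _; rewrite mpolyXD rmorphM mulrCA.
apply: generatedM; rewrite /lower big_seq_cond; apply: generated_sum => u.
move=> /andP[ug uu0]; apply: generatedM; apply: IH.
rewrite -beE ![(be + _)%MM]addmC; apply: (strict_orderD ordx).
by split; [rewrite -lmg; apply: lm_max | apply/eqP].
Qed.

End MonomialGenerators.

(** * The presentation of B' *)

Section RenameSupport.
Variables (k : comNzRingType) (a N : nat) (f : 'I_a -> 'I_N).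
Implicit Type p : {mpoly k[a]}.

Lemma renameE p : rename f p = \sum_(u <- msupp p) p@_u *: 'X_[mpush f u].
Proof.
rewrite {1}[p]mpolyE rmorph_sum; apply: eq_bigr => u _ /=.
by rewrite renameZ renameX.
Qed.

Lemma msupp_rename p w : w \in msupp (rename f p) ->
  exists2 u, u \in msupp p & w = mpush f u.
Proof.
rewrite renameE big_seq => /msupp_sum_le /flattenP[_ /mapP[u + ->]].
rewrite mem_filter => /andP[up _] /msuppZ_le.
by rewrite msuppX inE => /eqP->; exists u.
Qed.

Lemma mcoeff_rename p u : injective f -> (rename f p)@_(mpush f u) = p@_u.
Proof.
move=> injf; rewrite renameE [in RHS](mpolyE p) !raddf_sum; apply: eq_bigr => v _ /=.
rewrite !mcoeffZ !mcoeffX; congr (_ * (nat_of_bool _)%:R); apply/eqP/eqP => [h|->//].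
by apply/mnmP => i; rewrite -!(mpush_in _ _ injf) h.
Qed.

End RenameSupport.

Section Presentation.
Variables (k : fieldType) (m n r : nat).
Local Notation Y := {mpoly k[m]}.
Local Notation R0 := {mpoly k[m + n]}.
Local Notation S := {mpoly k[m + n + (1 + r)]}.
Local Notation var_y := (@var_y m n r).
Local Notation var_x := (@var_x m n r).
Local Notation var_t := (var_t m n r).
Local Notation var_u := (@var_u m n r).
Local Notation var_yx := (@var_yx m n r).

Lemma var_cases (Q : 'I_(m + n + (1 + r)) -> Prop) :
  (forall i, Q (var_y i)) -> (forall i, Q (var_x i)) -> Q var_t ->
  (forall i, Q (var_u i)) -> forall i, Q i.
Proof.
move=> Qy Qx Qt Qu i; rewrite -[i]splitK; case: (split i) => [j|j] /=.
  by rewrite -[j]splitK; case: (split j) => l /=; [apply: Qy | apply: Qx].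
rewrite -[j]splitK; case: (split j) => l /=; last exact: Qu.
by rewrite ord1; apply: Qt.
Qed.

(** Serves both for substitutions, with polynomial values, and for exponent vectors, with values in
    [nat]. *)
Definition subst_var (A : Type) (y : 'I_m -> A) (x : 'I_n -> A) (t : A) (u : 'I_r -> A)
    (i : 'I_(m + n + (1 + r))) : A :=
  match split i with
  | inl j => match split j with inl l => y l | inr l => x l end
  | inr j => match split j with inl _ => t | inr l => u l end
  end.

Section SubstVar.
Variables (A : Type) (y : 'I_m -> A) (x : 'I_n -> A) (t : A) (u : 'I_r -> A).
Lemma subst_var_y i : subst_var y x t u (var_y i) = y i.
Proof. by rewrite /subst_var !(unsplitK (inl _)). Qed.
Lemma subst_var_x i : subst_var y x t u (var_x i) = x i.
Proof. by rewrite /subst_var (unsplitK (inl _)) (unsplitK (inr _)). Qed.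
Lemma subst_var_t : subst_var y x t u var_t = t.
Proof. by rewrite /subst_var (unsplitK (inr _)) (unsplitK (inl _)). Qed.
Lemma subst_var_u i : subst_var y x t u (var_u i) = u i.
Proof. by rewrite /subst_var !(unsplitK (inr _)). Qed.
Definition subst_varE := (subst_var_y, subst_var_x, subst_var_t, subst_var_u).
End SubstVar.

Lemma var_y_inj : injective var_y.
Proof. by move=> i j /lshift_inj/lshift_inj. Qed.

(** A candidate relation c between the m_j, encoded as a linear form in u; its monomials are the
    [ymon v j]. *)
Definition ylin (c : 'I_r -> Y) : S := \sum_(j < r) rename var_y (c j) * 'X_(var_u j).

Definition ymon (v : 'X_{1..m}) (j : 'I_r) : 'X_{1..m + n + (1 + r)} :=
  (U_(var_u j) + mpush var_y v)%MM.

Lemma var_uy j i : (var_u j == var_y i) = false.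
Proof.
by apply/negbTE; rewrite -val_eqE /= neq_ltn orbC (leq_trans (ltn_ord i)) //
  -addnA leq_addr.
Qed.
Lemma var_ux j i : (var_u j == var_x i) = false.
Proof.
apply/negbTE; rewrite -val_eqE /= neq_ltn orbC.
by rewrite (leq_trans _ (leq_addr _ _)) // ltn_add2l.
Qed.
Lemma var_ut j : (var_u j == var_t) = false.
Proof. by apply/negbTE; rewrite -val_eqE /= eqn_add2l. Qed.

Lemma mpush_yE v i : mpush var_y v i = subst_var v (fun=> 0%N) 0%N (fun=> 0%N) i.
Proof.
elim/var_cases: i => [i|i||i]; rewrite subst_varE ?(mpush_in _ _ var_y_inj) //.
- apply: mpush_out => j; rewrite -val_eqE /= neq_ltn.
  by rewrite (leq_trans (ltn_ord j)) // leq_addr.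
- apply: mpush_out => j; rewrite -val_eqE /= neq_ltn.
  by rewrite (leq_trans (ltn_ord j)) // addn0 leq_addr.
- by apply: mpush_out => j; rewrite eq_sym var_uy.
Qed.

Lemma ymonE v j i : ymon v j i =
  subst_var v (fun=> 0%N) 0%N (fun l => (j == l) : nat) i.
Proof.
rewrite /ymon mnmDE mnm1E mpush_yE.
elim/var_cases: i => [i|i||i]; rewrite !subst_varE ?(var_uy, var_ux, var_ut) //.
by rewrite addn0 (inj_eq (f := var_u)) // => a b /rshift_inj/rshift_inj.
Qed.

Lemma msupp_ylin c w : w \in msupp (ylin c) -> exists v j, w = ymon v j.
Proof.
move=> /msupp_sum_le /flattenP[_ /mapP[j _ ->]].
rewrite (perm_mem (msuppMX _ _)) => /mapP[w' /msupp_rename[v _ ->] ->].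
by exists v, j.
Qed.

Lemma mcoeff_ylin c v j : (ylin c)@_(ymon v j) = (c j)@_v.
Proof.
rewrite raddf_sum (bigD1 j) //= big1 ?addr0 => [|i ij].
  by rewrite mcoeffMX (mcoeff_rename _ _ var_y_inj).
apply/memN_msupp_eq0; rewrite (perm_mem (msuppMX _ _)); apply/negP.
move=> /mapP[w' /msupp_rename[v' _ ->]] /mnmP/(_ (var_u j)).
rewrite -/(ymon v' i) !ymonE !subst_varE eqxx.
by rewrite (negPf ij).
Qed.

Lemma ylin_eq0 c : ylin c = 0 -> forall j, c j = 0.
Proof. by move=> c0 j; apply/mpolyP => v; rewrite -mcoeff_ylin c0 !mcoeff0. Qed.

Lemma ylinB c c' : ylin c - ylin c' = ylin (fun j => c j - c' j).
Proof. by rewrite -sumrB; apply: eq_bigr => j _; rewrite rmorphB mulrBl. Qed.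

Lemma ylinM q c : rename var_y q * ylin c = ylin (fun j => q * c j).
Proof. by rewrite mulr_sumr; apply: eq_bigr => j _; rewrite rmorphM mulrA. Qed.

Lemma rename_ylin q j :
  rename var_y q * 'X_(var_u j) = ylin (fun i => (i == j)%:R * q).
Proof.
rewrite /ylin (bigD1 j) //= big1 ?addr0 => [|i ij]; first by rewrite eqxx mul1r.
by rewrite (negPf ij) mul0r rmorph0 mul0r.
Qed.

Section Specialisation.
Variables (I : ideal R0) (mon : r.-tuple 'X_{1..n}).

(** The substitution t = 1, u_j = m_j. It maps L into I and a linear form to the combination of the
    m_j that it encodes. *)
Definition spec_tu : {rmorphism S -> R0} := comp_mpoly
  [tuple subst_var (fun i => 'X_(lshift n i)) (fun i => 'X_(rshift m i)) 1
    (fun j => incl_x m 'X_[tnth mon j]) i | i < _].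

Lemma spec_tuX i : spec_tu 'X_i =
  subst_var (fun i => 'X_(lshift n i)) (fun i => 'X_(rshift m i)) 1
    (fun j => incl_x m 'X_[tnth mon j]) i.
Proof. by rewrite /spec_tu /= comp_mpolyXU -tnth_nth tnth_mktuple. Qed.

Lemma spec_tuC c : spec_tu c%:MP = c%:MP.
Proof. exact: comp_mpolyC. Qed.

Lemma spec_tu_yx p : spec_tu (rename var_yx p) = p.
Proof.
pose phi : {rmorphism R0 -> R0} := spec_tu \o rename var_yx.
apply: (mpoly_rmorph_eq (phi := phi) (psi := idfun)) => [c|i] /=.
  by rewrite renameC spec_tuC.
rewrite renameXi spec_tuX /subst_var (unsplitK (inl _)).
by rewrite -[X in _ = 'X_X]splitK; case: split.
Qed.

Lemma rename_yx_incl_y q : rename var_yx (incl_y k m n q) = rename var_y q.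
Proof.
pose phi : {rmorphism Y -> S} := rename var_yx \o incl_y k m n.
apply: (mpoly_rmorph_eq (phi := phi) (psi := rename var_y)) => [c|i] /=.
  by rewrite /incl_y !renameC.
by rewrite /incl_y !renameXi.
Qed.

Lemma rename_yx_incl_x (q : {mpoly k[n]}) : rename var_yx (incl_x m q) = rename var_x q.
Proof.
pose phi : {rmorphism {mpoly k[n]} -> S} := rename var_yx \o @incl_x k m n.
apply: (mpoly_rmorph_eq (phi := phi) (psi := rename var_x)) => [c|i] /=.
  by rewrite /incl_x !renameC.
by rewrite /incl_x !renameXi.
Qed.

Lemma spec_tu_y q : spec_tu (rename var_y q) = incl_y k m n q.
Proof. by rewrite -rename_yx_incl_y spec_tu_yx. Qed.

Lemma spec_tu_ylin c :
  spec_tu (ylin c) = \sum_(j < r) incl_y k m n (c j) * incl_x m 'X_[tnth mon j].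
Proof.
rewrite rmorph_sum; apply: eq_bigr => j _.
by rewrite rmorphM spec_tu_y spec_tuX subst_varE.
Qed.

Lemma spec_tu_L f : ideal_L I mon f -> I (spec_tu f).
Proof.
move=> /(_ (ideal_preim spec_tu I)); apply=> _ [[p Ip <-]|[j _ <-]].
  by rewrite /ideal_preim /preimage /= spec_tu_yx.
rewrite /ideal_preim /preimage /= rmorphB rmorphM !spec_tuX !subst_varE mul1r.
by rewrite -rename_yx_incl_x spec_tu_yx subrr; apply: ideal0.
Qed.

(** Because sum c_j u_j = sum c_j (u_j - t m_j) + t (sum c_j m_j). *)
Lemma ylin_L c :
  I (\sum_(j < r) incl_y k m n (c j) * incl_x m 'X_[tnth mon j]) ->
  ideal_L I mon (ylin c).
Proof.
move=> Ic; pose L := ideal_L I mon.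
have -> : ylin c = \sum_(j < r) rename var_y (c j) *
      ('X_(var_u j) - 'X_var_t * rename var_x 'X_[tnth mon j]) +
    'X_var_t * rename var_yx
      (\sum_(j < r) incl_y k m n (c j) * incl_x m 'X_[tnth mon j]).
  rewrite rmorph_sum mulr_sumr -big_split; apply: eq_bigr => j _ /=.
  by rewrite rmorphM /= rename_yx_incl_y rename_yx_incl_x mulrBr mulrCA subrK.
apply: (idealD (i := L)); last first.
  apply: (idealM (i := L)); apply: sub_ideal_span; left.
  by exists (\sum_(j < r) incl_y k m n (c j) * incl_x m 'X_[tnth mon j]).
elim/big_ind: _ => [|p q|j _]; first exact: (ideal0 L).
  exact: (idealD (i := L)).
by apply: (idealM (i := L)); apply: sub_ideal_span; right; exists j.
Qed.

End Specialisation.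
End Presentation.

Section Syzygies.
Variables (k : fieldType) (m n r : nat).
Local Notation Y := {mpoly k[m]}.
Local Notation R0 := {mpoly k[m + n]}.
Local Notation S := {mpoly k[m + n + (1 + r)]}.
Local Notation var_y := (@var_y m n r).
Local Notation var_x := (@var_x m n r).
Local Notation var_t := (var_t m n r).
Local Notation var_u := (@var_u m n r).
Local Notation var_xt := (@var_xt m n r).
Implicit Type w : 'X_{1..m + n + (1 + r)}.

Lemma mrestr_xt_eq w w' : mrestr var_xt w = mrestr var_xt w' <->
  (forall i, w (var_x i) = w' (var_x i)) /\ w var_t = w' var_t.
Proof.
split=> [/mnmP h|[hx ht]].
  split=> [i|].
    by have := h (lshift 1 i); rewrite !mnmE /Defs.var_xt (unsplitK (inl _)).
  by have := h (rshift n ord0); rewrite !mnmE /Defs.var_xt (unsplitK (inr _)).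
by apply/mnmP => i; rewrite !mnmE /Defs.var_xt; case: split.
Qed.

Lemma mdeg_in_u w : mdeg_in (@is_var_u m n r) w = (\sum_(j < r) w (var_u j))%N.
Proof.
rewrite /mdeg_in big_mkcond big_split_ord /= big1 ?add0n => [|i _].
  rewrite big_split_ord /= big_ord1 /is_var_u /= addn0 ltnn add0n.
  by apply: eq_bigr => j _; rewrite -{1}[(m + n)%N]addn0 ltn_add2l.
by rewrite /is_var_u /= ltnNge ltnW.
Qed.

Lemma mdeg_in_tu w : mdeg_in (@is_var_tu m n r) w =
  (w var_t + \sum_(j < r) w (var_u j))%N.
Proof.
rewrite /mdeg_in big_mkcond big_split_ord /= big1 ?add0n => [|i _].
  rewrite big_split_ord /= big_ord1 /is_var_tu /= leq_addr; congr (_ + _)%N.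
  by apply: eq_bigr => j _; rewrite leq_addr.
by rewrite /is_var_tu /= leqNgt ltn_ord.
Qed.

Lemma sum_ymon v j : (\sum_(l < r) ymon n v j (var_u l) = 1)%N.
Proof.
rewrite (bigD1 j) //= big1 ?addn0 => [|l lj]; rewrite ymonE subst_varE ?eqxx //.
by rewrite eq_sym (negPf lj).
Qed.

Variables (Txt : rel 'X_{1..n + 1}) (Tu : rel 'X_{1..r}) (Ty : rel 'X_{1..m}).
Hypotheses (ordxt : monomial_order Txt) (ordu : monomial_order Tu).
Hypothesis ordy : monomial_order Ty.
Let T := block_order_xtuy Txt Tu Ty.

Lemma block_order_xtuy_monomial : monomial_order T.
Proof.
apply/monomial_orderP; split.
  apply/(block_preorder _ ordxt)/(block_preorder _ ordu).
  exact: (order_on_preorder _ ordy).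
move=> u v /andP[uv vu].
have [/mrestr_xt_eq[hx ht] [uv1 vu1]] := block_order_anti ordxt uv vu.
have [/mnmP hu [uv2 vu2]] := block_order_anti ordu uv1 vu1.
have /mnmP hy := order_anti ordy uv2 vu2.
apply/mnmP; elim/var_cases=> [i|||i] //.
  by have := hy i; rewrite !mnmE.
by have := hu i; rewrite !mnmE.
Qed.

Variables (I : ideal R0) (mon : r.-tuple 'X_{1..n}) (H : seq S) (s : nat).
Variable N : 'M[Y]_(r, s).
Hypothesis GB : groebner_basis T (ideal_L I mon) H.
Hypothesis homH : forall h, h \in H -> homogeneous_in (@is_var_tu m n r) h.
Hypothesis presN : presentation_matrix H N.

(** A column is an element of L, and [spec_tu] turns it into a relation between the m_i. *)
Lemma presentation_col j :
  I (\sum_(i < r) incl_y k m n (N i j) * incl_x m 'X_[tnth mon i]).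
Proof.
have [h [_ hH hN]] := presN.
rewrite -spec_tu_ylin; apply: spec_tu_L.
have -> : ylin n (N^~ j) = tnth h j by rewrite hN.
by apply: GB.1; have := mem_tnth j h; rewrite hH => /and3P[].
Qed.

(* An element of L that is linear in u and free of x and t is reduced by the
   elements of H in k[y, u] of degree 0 in u, which lie in J, and of degree 1,
   which are the columns of N. *)
Lemma syzygy_ylin (f : S) : ideal_L I mon f -> forall c, f = ylin n c ->
  exists d : 'cV[Y]_s, forall i, elim_ideal I (c i - (N *m d) i ord0).
Proof.
move: f; apply: (groebner_ind block_order_xtuy_monomial GB) => [c c0|f g ka Lf f0 gH g0].
  exists 0 => i; rewrite mulmx0 mxE subr0 (ylin_eq0 (esym c0)).
  exact: ideal0.
rewrite -/T => dvd IH c fE.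
have [v [j lmf]] : exists v j, lm T f = ymon n v j.
  by apply: (@msupp_ylin _ _ _ _ c); rewrite -fE (lm_mem block_order_xtuy_monomial).
move: dvd IH; rewrite lmf => dvd; have dvdP i := mnm_lepP dvd i.
have lmg_x i : lm T g (var_x i) = 0%N.
  by have := dvdP (var_x i); rewrite ymonE subst_varE leqn0 => /eqP.
have lmg_t : lm T g var_t = 0%N.
  by have := dvdP var_t; rewrite ymonE subst_varE leqn0 => /eqP.
(* The leading monomial of g divides y^v u_j, so it is free of x and t; as the block [x, t]
   dominates, so is every monomial of g. *)
have g_xt w : w \in msupp g -> (forall i, w (var_x i) = 0%N) /\ w var_t = 0%N.
  move=> /(lm_max block_order_xtuy_monomial)/(block_order_le ordxt).
  have -> : mrestr var_xt (lm T g) = 0%MM.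
    rewrite -(mrestr0 var_xt); apply/mrestr_xt_eq.
    by split=> [i|]; rewrite mnm0E.
  move=> /(order_le0 ordxt); rewrite -(mrestr0 var_xt) => /mrestr_xt_eq[hx ->].
  by split=> [i|]; rewrite ?hx mnm0E.
(* Without t, homogeneity in (t, u) becomes homogeneity in u, of degree at most 1 since the leading
   monomial divides y^v u_j. *)
have [D homg] := homH gH.
have g_u w : w \in msupp g -> (\sum_(l < r) w (var_u l) = D)%N.
  by move=> wg; rewrite -(homg w wg) mdeg_in_tu; have [_ ->] := g_xt w wg.
have lmg_g : lm T g \in msupp g := lm_mem block_order_xtuy_monomial g0.
have D1 : (D <= 1)%N.
  apply: leq_trans (eq_leq (sum_ymon v j)); rewrite -(g_u _ lmg_g).
  by apply: leq_sum => l _.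
set gam := (_ - _)%MM.
pose gy : 'X_{1..m} := mrestr var_y gam.
have Ig : I (spec_tu k m mon g) by apply: spec_tu_L; apply: GB.1.
have [D0|D1'] := leqP D 0.
  have {D1}D0 : D = 0%N by apply/eqP; rewrite -leqn0.
  have u0 w l : w \in msupp g -> w (var_u l) = 0%N.
    move=> /g_u; rewrite D0 => /eqP; rewrite sum_nat_eq0 => /forallP/(_ l).
    by move=> /eqP.
  (* In degree 0, g is a polynomial in y and lies in J, so the reduction changes only the j-th
     coefficient, by an element of J. *)
  pose g1 : Y := \sum_(w <- msupp g) g@_w *: 'X_[mrestr var_y w].
  have gE : g = rename var_y g1.
    rewrite rmorph_sum [LHS]mpolyE big_seq [RHS]big_seq; apply: eq_bigr => w wg.
    rewrite /= renameZ renameX; congr (_ *: 'X_[_]).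
    apply/mnmP; elim/var_cases=> [i|i||l]; rewrite mpush_yE subst_varE.
    - by rewrite mnmE.
    - by have [] := g_xt w wg.
    - by have [] := g_xt w wg.
    - exact: u0.
  have gamE : gam = ymon n gy j.
    apply/mnmP; elim/var_cases=> [i|i||l]; rewrite mnmBE !ymonE !subst_varE.
    - by rewrite mnmE mnmBE ymonE subst_varE.
    - by rewrite lmg_x.
    - by rewrite lmg_t.
    - by rewrite u0 // subn0.
  pose q := ka *: 'X_[gy] * g1.
  have -> : f - ka *: 'X_[gam] * g = ylin n (fun i => c i - (i == j)%:R * q).
    rewrite fE -ylinB -rename_ylin; congr (_ - _).
    rewrite gamE /ymon addmC mpolyXD gE /q rmorphM /= renameZ renameX.
    by rewrite -!scalerAl mulrAC.
  move=> /(_ _ (erefl _)) [d dP]; exists d => i.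
  have -> : c i - (N *m d) i ord0 =
    (c i - (i == j)%:R * q - (N *m d) i ord0) + (i == j)%:R * q.
    by rewrite addrAC subrK.
  apply: (idealD (i := elim_ideal I)); first exact: dP.
  apply: (idealM (i := elim_ideal I)); apply: (idealM (i := elim_ideal I)).
  have : I (incl_y k m n g1) by rewrite -(@spec_tu_y _ _ _ _ mon) -gE.
  by [].
have {D1 D1'}D1 : D = 1%N by apply/eqP; rewrite eqn_leq D1.
have [h [_ hH hN]] := presN.
have gh : g \in h.
  rewrite hH gH /=; apply/andP; split.
    apply/allP => w wg; apply/forallP; elim/var_cases=> [i|i||l]; apply/orP.
    - by left; rewrite /is_var_yu /= ltn_ord.
    - by right; have [-> _] := g_xt w wg.
    - by right; have [_ ->] := g_xt w wg.
    - by left; rewrite /is_var_yu /is_var_u /= -{2}[(m + n)%N]addn0 ltn_add2l orbT.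
  rewrite /deg_in eqn_leq; apply/andP; split.
    by apply/bigmax_leqP_seq => w wg _; rewrite mdeg_in_u g_u // D1.
  have := leq_bigmax_seq (F := mdeg_in (@is_var_u m n r)) (P := predT) _ lmg_g isT.
  by rewrite mdeg_in_u (g_u _ lmg_g) D1.
have /tnthP[l gl] := gh.
have gE : g = ylin n (N^~ l) by rewrite gl hN.
have [v' [j' lmgE]] : exists v j, lm T g = ymon n v j.
  by apply: (@msupp_ylin _ _ _ _ (N^~ l)); rewrite -gE.
(* In degree 1, g is the column [l], and the u-variable of its leading monomial is cancelled
   entirely, so the cofactor is a monomial in y. *)
have jj' : j = j'.
  have := dvdP (var_u j'); rewrite lmgE !ymonE !subst_varE eqxx.
  by case: eqVneq.
have gamE : gam = mpush var_y gy.
  apply/mnmP; elim/var_cases=> [i|i||i]; rewrite mpush_yE mnmBE lmgE !ymonE !subst_varE //.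
    by rewrite mnmE mnmBE lmgE !ymonE !subst_varE.
  by rewrite jj' subnn.
pose q := ka *: 'X_[gy] : Y.
have -> : f - ka *: 'X_[gam] * g = ylin n (fun i => c i - q * N i l).
  by rewrite -ylinB -ylinM -fE -gE /q renameZ renameX gamE.
move=> /(_ _ (erefl _)) [d dP]; exists (d + q *: delta_mx l ord0) => i.
have -> : (N *m (d + q *: delta_mx l ord0)) i ord0 = (N *m d) i ord0 + q * N i l.
  by rewrite mulmxDr -scalemxAr -colE [LHS]mxE [X in _ + X]mxE [X in _ * X]mxE.
by have := dP i; rewrite /= addrAC -addrA -opprD.
Qed.

(** With [presentation_col]: N presents B' over A. *)
Lemma syzygy (c : 'I_r -> Y) :
  I (\sum_(i < r) incl_y k m n (c i) * incl_x m 'X_[tnth mon i]) ->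
  exists d : 'cV[Y]_s, forall i, elim_ideal I (c i - (N *m d) i ord0).
Proof. by move=> /ylin_L/syzygy_ylin/(_ c); apply. Qed.

End Syzygies.

(** * Localisation *)

Section LocIn.
Variables (R : comPzRingType) (a : R).

Definition loc_in (x : R) : loc a := loc_frac a x 0.

Lemma loc_in_is_zmod_morphism : zmod_morphism loc_in.
Proof. by move=> x y; rewrite /loc_in loc_fracN loc_fracD expr0 !mulr1. Qed.
Lemma loc_in_is_monoid_morphism : monoid_morphism loc_in.
Proof. by split=> // x y; rewrite /loc_in loc_fracM. Qed.
HB.instance Definition _ :=
  GRing.isZmodMorphism.Build R (loc a) loc_in loc_in_is_zmod_morphism.
HB.instance Definition _ :=
  GRing.isMonoidMorphism.Build R (loc a) loc_in loc_in_is_monoid_morphism.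

Lemma loc_in_eq0 x : loc_in x = 0 <-> exists l, a ^+ l * x = 0.
Proof.
split=> [/loc_fracP[l]|[l h]].
  by rewrite expr0 mul0r mulr0 mulr1 => h; exists l.
by apply/loc_fracP; exists l; rewrite expr0 mul0r mulr0 mulr1.
Qed.

Lemma loc_in_unit : loc_frac a 1 1 * loc_in a = 1.
Proof.
rewrite loc_fracM; apply/loc_fracP; exists 0%N.
by rewrite !expr0 expr1 !mulr1 !mul1r.
Qed.

Lemma loc_in_denom p : exists l x, loc_in (a ^+ l) * p = loc_in x.
Proof.
elim/locW: p => x i; exists i, x; rewrite loc_fracM; apply/loc_fracP; exists 0%N.
by rewrite !expr0 mulr1 !mul1r add0n mulrC.
Qed.

End LocIn.

(** The sum of finitely many exponents is a common upper bound; this is used to choose common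
    denominators. *)
Lemma uniform_exponent (T : finType) (Q : T -> nat -> Prop) :
  (forall i l l', Q i l -> Q i (l + l')%N) -> (forall i, exists l, Q i l) ->
  exists l, forall i, Q i l.
Proof.
move=> mono /choice[l lP]; exists (\sum_i l i)%N => i.
by rewrite (bigD1 i) //=; apply: mono.
Qed.

(** * Finite flatness of a localisation in terms of congruences modulo J and I *)

Section FiniteFlat.
Variables (Y S : comPzRingType) (phi : {rmorphism Y -> S}) (I : ideal S).
Local Notation J := (ideal_preim phi I).
Variable a : Y.
Local Notation ax := (quot_pi J a).
Local Notation bx := (quot_map phi I ax).
Local Notation M := (restr (loc_map (quot_map phi I) ax)).

(** For Y = k[y] and S = k[y, x], [iota] goes to A_a and [kappa] to B_a as an A_a-module. Every
    element becomes an image after multiplication by a power of a, and vanishing of an image means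
    membership in J or I up to such a power. *)
Definition iota : {rmorphism Y -> loc ax} := @loc_in _ ax \o quot_pi J.
Definition kappa (f : S) : M := loc_in bx (quot_pi I f).

Lemma kappa_is_zmod_morphism : zmod_morphism kappa.
Proof. by move=> f g; rewrite /kappa !rmorphB. Qed.
HB.instance Definition _ :=
  GRing.isZmodMorphism.Build S M kappa kappa_is_zmod_morphism.

Lemma kappaB f g : kappa (f - g) = kappa f - kappa g.
Proof. exact: raddfB. Qed.

Lemma iota_eq0 y : iota y = 0 <-> exists l, J (a ^+ l * y).
Proof.
rewrite /iota /= loc_in_eq0; split=> -[l h]; exists l.
  by apply/(@quot_pi_eq0 _ J); rewrite rmorphM rmorphXn.
by rewrite -rmorphXn -rmorphM; apply/(@quot_pi_eq0 _ J).
Qed.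

Lemma iota_denom z : exists l y, iota (a ^+ l) * z = iota y.
Proof.
have [l [q h]] := loc_in_denom z; exists l, (repr q).
by rewrite /iota /= quot_piK rmorphXn.
Qed.

Lemma iota_unit l : exists u, u * iota (a ^+ l) = 1.
Proof.
exists (loc_frac ax 1 1 ^+ l); rewrite rmorphXn -exprMn.
by rewrite [X in X ^+ _]loc_in_unit expr1n.
Qed.

Lemma loc_map_iota y :
  loc_map (quot_map phi I) ax (iota y) = loc_in bx (quot_pi I (phi y)).
Proof. by rewrite -[quot_pi I (phi y)]quot_mapE; apply: loc_mapE. Qed.

Lemma denomXn l : quot_pi I (phi (a ^+ l)) = bx ^+ l.
Proof. by rewrite !rmorphXn /= -(quot_mapE phi I a). Qed.

Lemma kappaZ y f : iota y *: kappa f = kappa (phi y * f).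
Proof.
transitivity (loc_map (quot_map phi I) ax (iota y) * loc_in bx (quot_pi I f)) => //.
by rewrite loc_map_iota -!rmorphM.
Qed.

Lemma kappa_eq0 f : kappa f = 0 <-> exists l, I (phi (a ^+ l) * f).
Proof.
rewrite /kappa loc_in_eq0; split=> -[l h]; exists l.
  apply/quot_pi_eq0; transitivity (bx ^+ l * quot_pi I f) => //.
  by rewrite -denomXn -rmorphM.
by rewrite -denomXn -rmorphM; apply/quot_pi_eq0.
Qed.

Lemma kappa_denom (v : M) : exists l f, iota (a ^+ l) *: v = kappa f.
Proof.
have [l [q h]] := loc_in_denom (v : loc bx); exists l, (repr q).
transitivity (loc_map (quot_map phi I) ax (iota (a ^+ l)) * (v : loc bx)) => //.
by rewrite /kappa quot_piK -h loc_map_iota denomXn.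
Qed.

Lemma iota_common_denom (T : finType) (z : T -> loc ax) :
  exists l (y : T -> Y), forall i, iota (a ^+ l) * z i = iota (y i).
Proof.
have [|i|l /choice[y yP]] := @uniform_exponent T
  (fun i l => exists y, iota (a ^+ l) * z i = iota y); last by exists l, y.
  move=> i l l' [y h]; exists (a ^+ l' * y).
  by rewrite exprD !rmorphM mulrAC h mulrC.
exact: iota_denom.
Qed.

Lemma kappa_common_denom (T : finType) (v : T -> M) :
  exists l (f : T -> S), forall i, iota (a ^+ l) *: v i = kappa (f i).
Proof.
have [|i|l /choice[f fP]] := @uniform_exponent T
  (fun i l => exists f, iota (a ^+ l) *: v i = kappa f); last by exists l, f.
  move=> i l l' [f h]; exists (phi (a ^+ l') * f).
  by rewrite exprD mulrC rmorphM -scalerA h kappaZ.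
exact: kappa_denom.
Qed.

Section Presented.
Variables (r s : nat) (e : 'I_r -> S) (N : 'M[Y]_(r, s)).
Hypothesis rel : forall c : 'I_r -> Y, I (\sum_(i < r) phi (c i) * e i) ->
  exists d : 'cV[Y]_s, forall i, J (c i - (N *m d) i ord0).
Hypothesis col : forall j, I (\sum_(i < r) phi (N i j) * e i).

Lemma iota_cancel l (x y : loc ax) : iota (a ^+ l) * x = iota (a ^+ l) * y -> x = y.
Proof.
have [u ul] := iota_unit l => h.
by rewrite -[x]mul1r -[y]mul1r -ul -!mulrA h.
Qed.

Lemma kappa_comb (c : 'I_r -> Y) :
  \sum_(i < r) iota (c i) *: kappa (e i) = kappa (\sum_(i < r) phi (c i) * e i).
Proof. by rewrite raddf_sum; apply: eq_bigr => i _; rewrite kappaZ. Qed.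

(** Clearing denominators turns a relation over the localisation into one to which [rel] applies;
    the inverse of the power of a then undoes the scaling. *)
Lemma loc_relations (c : 'cV[loc ax]_r) :
  \sum_(i < r) c i ord0 *: kappa (e i) = 0 <->
  exists x : 'cV[loc ax]_s, c = map_mx iota N *m x.
Proof.
split=> [c0|[x ->]].
  have [l [y yP]] := iota_common_denom (fun i => c i ord0).
  have : kappa (\sum_(i < r) phi (y i) * e i) = 0.
    rewrite -kappa_comb; under eq_bigr => i _ do rewrite -yP -scalerA.
    by rewrite -scaler_sumr c0 scaler0.
  move=> /kappa_eq0[l']; rewrite mulr_sumr.
  under eq_bigr => i _ do rewrite mulrA -rmorphM.
  move=> /rel[d dP]; have [u uP] := iota_unit (l' + l).
  exists (u *: map_mx iota d); apply/matrixP=> i j; rewrite ord1 -scalemxAr.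
  apply: (@iota_cancel (l' + l)).
  rewrite [X in _ = _ * X]mxE [RHS]mulrA [_ * u]mulrC uP mul1r -map_mxM.
  rewrite [RHS]mxE exprD rmorphM -mulrA yP -rmorphM.
  apply/eqP; rewrite -subr_eq0 -rmorphB; apply/eqP/iota_eq0; exists 0%N.
  by rewrite mul1r; apply: dP.
have colz j : \sum_(i < r) iota (N i j) *: kappa (e i) = 0.
  by rewrite kappa_comb; apply/kappa_eq0; exists 0%N; rewrite rmorph1 mul1r.
under eq_bigr => i _ do rewrite mxE scaler_suml.
rewrite exchange_big big1 // => j _.
under eq_bigr => i _ do rewrite mxE mulrC -scalerA.
by rewrite -scaler_sumr colz scaler0.
Qed.

(** Dividing a^l N = N C N by the unit a^l gives the identity required by [regular_flat]. *)
Lemma finite_flat_of_regular (C : 'M[Y]_(s, r)) l :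
  (forall f, generated phi I e a f) ->
  (forall i j, J (a ^+ l * N i j - (N *m C *m N) i j)) ->
  finite_module M /\ flat_module M.
Proof.
move=> gen reg.
have genM (v : M) : exists c : 'cV[loc ax]_r, v = \sum_(i < r) c i ord0 *: kappa (e i).
  have [l1 [f vf]] := kappa_denom v; have [l2 [c fc]] := gen f.
  have [u uP] := iota_unit (l2 + l1).
  exists (\col_i (u * iota (c i))); rewrite -[v]scale1r -uP -scalerA.
  under eq_bigr => i _ do rewrite mxE -scalerA.
  rewrite -scaler_sumr kappa_comb exprD rmorphM -scalerA vf kappaZ; congr (_ *: _).
  apply/eqP; rewrite -subr_eq0 -raddfB; apply/eqP/kappa_eq0; exists 0%N.
  by rewrite rmorph1 mul1r.
split.
  exists r, (kappa \o e) => v; have [c ->] := genM v.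
  by exists (fun i => c i ord0).
have [u uP] := iota_unit l.
apply: (regular_flat (N := map_mx iota N) (C := u *: map_mx iota C) genM).
  exact: loc_relations.
rewrite -scalemxAr -scalemxAl -!map_mxM; apply/matrixP=> i j; rewrite !mxE.
apply: (@iota_cancel l); rewrite [RHS]mulrA [_ * u]mulrC uP mul1r -rmorphM.
apply/eqP; rewrite -subr_eq0 -rmorphB; apply/eqP/iota_eq0; exists 0%N.
by rewrite mul1r; have := reg i j; rewrite !mxE.
Qed.

(** The e_j generate only after inverting [b], while finiteness holds after inverting [a].
    Expressing the finitely many generators of the module through the e_j costs one common factor,
    which is the [d] of [flat_regular]. *)
Lemma regular_of_flat (P : Spec Y) (b : Y) :
  ~ P a -> ~ P b -> (forall f, generated phi I e b f) ->
  finite_module M -> flat_module M ->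
  exists (C : 'M[Y]_(s, r)) delta, ~ P delta /\
    forall i j, J (delta * N i j - (N *m C *m N) i j).
Proof.
move=> Pa Pb gen [q [w wgen]] flatM.
have [l1 [f wf]] := kappa_common_denom w.
have [|i|l2 genf] := @uniform_exponent 'I_q (fun i l => exists c : 'I_r -> Y,
    I (phi (b ^+ l) * f i - \sum_(j < r) phi (c j) * e j)).
- move=> i l l' [c h]; exists (fun j => b ^+ l' * c j).
  under eq_bigr => j _ do rewrite rmorphM -mulrA.
  by rewrite -mulr_sumr addnC exprD rmorphM -mulrA -mulrBr; apply: idealM.
- exact: gen.
have [c cP] := choice genf.
pose d0 := b ^+ l2 * a ^+ l1.
have Pd0 : ~ P d0 by apply: spec_notM; apply: spec_notX.
have wc i : iota d0 *: w i = \sum_(j < r) iota (c i j) *: kappa (e j).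
  rewrite rmorphM -scalerA wf kappaZ kappa_comb.
  apply/eqP; rewrite -subr_eq0 -raddfB; apply/eqP/kappa_eq0; exists 0%N.
  by rewrite rmorph1 mul1r.
have [|C CP] := flat_regular (N := map_mx iota N) (e := kappa \o e) (d := iota d0)
    flatM _ loc_relations.
  move=> v; have [z ->] := wgen v.
  exists (\col_j \sum_(i < q) z i * iota (c i j)).
  under [RHS]eq_bigr => j _ do rewrite mxE scaler_suml.
  rewrite exchange_big scaler_sumr; apply: eq_bigr => i _ /=.
  rewrite scalerA mulrC -scalerA wc scaler_sumr.
  by apply: eq_bigr => j _; rewrite scalerA.
have [l3 [y yP]] := iota_common_denom (fun p : 'I_s * 'I_r => C p.1 p.2).
pose C0 := \matrix_(i, j) y (i, j).
have C0E : iota (a ^+ l3) *: C = map_mx iota C0.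
  by apply/matrixP=> i j; rewrite !mxE -yP.
have [|p|l4 l4P] := @uniform_exponent ('I_r * 'I_s)%type (fun p l =>
    J (a ^+ l * (a ^+ l3 * d0 * N p.1 p.2 - (N *m C0 *m N) p.1 p.2))).
- by move=> p l l' h; rewrite addnC exprD -mulrA; apply: (idealM (i := J)).
- apply/iota_eq0; rewrite rmorphB; apply/eqP; rewrite subr_eq0; apply/eqP.
  transitivity ((map_mx iota (N *m C0 *m N)) p.1 p.2); last by rewrite mxE.
  rewrite !map_mxM -C0E -scalemxAr -scalemxAl -CP !mxE.
  by rewrite (rmorphM iota (_ * d0)) (rmorphM iota _ d0) mulrA.
(* a^l3 clears the denominators of C, and a^l4 turns the equality of fractions into a congruence
   modulo J. *)
exists (a ^+ l4 *: C0), (a ^+ l4 * (a ^+ l3 * d0)); split.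
  apply: spec_notM; first exact: spec_notX.
  by apply: spec_notM => //; apply: spec_notX.
move=> i j; have := l4P (i, j); rewrite mulrBr /=; congr (ideal_fun J).
by rewrite -scalemxAr -scalemxAl [in RHS]mxE !mulrA.
Qed.

End Presented.
End FiniteFlat.

(* Cayley-Hamilton for multiplication by x on the image of S / I. *)
Lemma integral_of_finite (Y S : comPzRingType) (phi : {rmorphism Y -> S}) (I : ideal S)
    (a : Y) (x : S) :
  finite_module (restr (loc_map (quot_map phi I) (quot_pi (ideal_preim phi I) a))) ->
  exists q (C : 'M[Y]_q) D E,
    I (phi (a ^+ E) * \det ((phi (a ^+ D) * x)%:M - map_mx phi C)).
Proof.
move=> [q [w wgen]].
have [l1 [g wg]] := kappa_common_denom w.
(* The generators may be replaced by classes of elements g_j of S, at the cost of powers of a. *)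
have span f : exists l (c : 'I_q -> Y),
    I (phi (a ^+ l) * f - \sum_(j < q) phi (c j) * g j).
  have [z fz] := wgen (kappa phi I a f).
  have [l2 [c cP]] := iota_common_denom z.
  have : kappa phi I a (phi (a ^+ (l2 + l1)) * f - \sum_(j < q) phi (c j) * g j) = 0.
    rewrite kappaB -kappaZ -kappa_comb fz scaler_sumr -sumrB big1 // => j _.
    rewrite exprD rmorphM -cP -!scalerA -wg; apply/eqP; rewrite subr_eq0; apply/eqP.
    by rewrite !scalerA -mulrA (mulrC _ (z j)) mulrA.
  move=> /kappa_eq0[l3 h]; exists (l3 + (l2 + l1))%N, (fun j => a ^+ l3 * c j).
  under eq_bigr => j _ do rewrite rmorphM -mulrA.
  by rewrite -mulr_sumr exprD rmorphM -mulrA -mulrBr.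
have [|i|D spanx] := @uniform_exponent 'I_q (fun i l => exists c : 'I_q -> Y,
    I (phi (a ^+ l) * (x * g i) - \sum_(j < q) phi (c j) * g j)).
- move=> i l l' [c h]; exists (fun j => a ^+ l' * c j).
  under eq_bigr => j _ do rewrite rmorphM -mulrA.
  by rewrite -mulr_sumr addnC exprD rmorphM -mulrA -mulrBr; apply: idealM.
- exact: span.
have [c cP] := choice spanx; have [E [c1 c1P]] := span 1.
pose C : 'M[Y]_q := \matrix_(i, j) c i j.
exists q, C, D, E.
pose K := (phi (a ^+ D) * x)%:M - map_mx phi C.
have Kg i : I (\sum_j K i j * g j).
  suff -> : \sum_j K i j * g j = phi (a ^+ D) * (x * g i) - \sum_j phi (c i j) * g j.
    exact: cP.
  under eq_bigr => j _ do rewrite !mxE mulrBl.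
  rewrite sumrB; congr (_ - _); rewrite (bigD1 i) //= big1 ?addr0 => [|j ji].
    by rewrite eqxx mulr1n mulrA.
  by rewrite eq_sym (negPf ji) mulr0n mul0r.
have detK i : I (\det K * g i).
  suff -> : \det K * g i = \sum_l \adj K i l * (\sum_j K l j * g j).
    elim/big_ind: _ => [|y z|l _]; [exact: ideal0 | exact: idealD |].
    exact/idealM/Kg.
  transitivity ((\adj K *m K *m \col_j g j) i ord0).
    by rewrite mul_adj_mx mul_scalar_mx !mxE.
  rewrite -mulmxA mxE; apply: eq_bigr => l _; congr (_ * _).
  by rewrite mxE; apply: eq_bigr => j _; rewrite !mxE.
rewrite -/K.
(* [\det K] kills every g_j modulo I, and a^E 1 is a combination of the g_j. *)
have -> : phi (a ^+ E) * \det K =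
    \det K * (phi (a ^+ E) * 1 - \sum_j phi (c1 j) * g j) +
    \sum_j phi (c1 j) * (\det K * g j).
  rewrite mulr1 mulrBr [X in _ - X]mulr_sumr [LHS]mulrC.
  by under [X in _ - X]eq_bigr => j _ do rewrite mulrCA; rewrite subrK.
apply: idealD; first exact: idealM.
elim/big_ind: _ => [|y z|l _]; [exact: ideal0 | exact: idealD |].
exact/idealM/detK.
Qed.

(** Reads the determinant of [integral_of_finite] as the value at x of a polynomial over Y, whose
    leading coefficient, found next, is a product of powers of a. *)
Lemma horner_char_poly (Y S : comNzRingType) (phi : {rmorphism Y -> S}) (q : nat)
    (C : 'M[Y]_q) (b c : Y) (x : S) :
  (map_poly phi (c *: (char_poly C \Po (b *: 'X)))).[x] =
  phi c * \det ((phi b * x)%:M - map_mx phi C).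
Proof.
rewrite map_polyZ map_comp_poly map_char_poly map_polyZ map_polyX.
rewrite hornerZ horner_comp hornerZ hornerX; congr (_ * _).
rewrite -horner_evalE -det_map_mx; congr (\det _); apply/matrixP=> i j.
rewrite mxE /= horner_evalE !mxE.
by rewrite hornerD hornerN hornerC hornerMn hornerX.
Qed.

Lemma lead_coef_char_poly (Y : idomainType) (q : nat) (C : 'M[Y]_q) (b c : Y) :
  b != 0 -> lead_coef (c *: (char_poly C \Po (b *: 'X))) = c * b ^+ q.
Proof.
move=> b0; have szq : (1 < size (b *: 'X : {poly Y}))%N by rewrite size_scale // size_polyX.
rewrite lead_coefZ lead_coef_comp // (monicP (char_poly_monic C)) mul1r.
by rewrite lead_coefZ lead_coefX mulr1 size_char_poly.
Qed.

(** * The finite flat locus *)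

Section Locus.
Variables (k : fieldType) (m n : nat) (I : ideal {mpoly k[m + n]}).
Local Notation Y := {mpoly k[m]}.
Local Notation J := (elim_ideal I).
Implicit Type P : Spec (ringA I).

Lemma VAP (X : set Y) P : VA I X P <-> X `<=` pull_back P.
Proof.
split=> [XP y Xy|XP _ [y Xy <-]]; last exact: XP.
by apply: XP; exists y.
Qed.

Lemma nonfinite_locusPn P : ~ nonfinite_locus I P <->
  forall i, exists y, lc_ideal I i y /\ ~ pull_back P y.
Proof.
split=> [nW i|h [i _ /VAP JP]]; last by have [y [Jy]] := h i; apply; apply: JP.
apply: contrapT => h; apply: nW; exists i => //; apply/VAP => y Jy.
by apply: contrapT => Py; apply: h; exists y.
Qed.

Lemma VAPn (X : set Y) P : ~ VA I X P -> exists2 y, X y & ~ pull_back P y.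
Proof.
move=> nV; apply: contrapT => h; apply: nV; apply/VAP => y Xy.
by apply: contrapT => Py; apply: h; exists y.
Qed.

(** A finite union of closed sets is cut out by the products with one factor from each defining
    set. *)
Lemma locus_complement_open (X : set Y) :
  spec_open (~` (nonfinite_locus I `|` VA I X)).
Proof.
exists [set quot_pi J ((\prod_i w.1 i) * w.2) | w in
  [set w : ('I_n -> Y) * Y | (forall i, lc_ideal I i (w.1 i)) /\ X w.2]].
apply/predeqP => P; split; apply: contra_not => hP; last first.
  move=> _ [[y f] /= [Jy Xf] <-]; rewrite rmorphM /=; case: hP => [[i _ /VAP WP]|/VAP VP].
    rewrite mulrC; apply: (idealM (i := spec_ideal P)).
    rewrite (bigD1 i) //= mulrC rmorphM; apply: (idealM (i := spec_ideal P)).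
    exact: (WP _ (Jy i)).
  by apply: (idealM (i := spec_ideal P)); apply: VP.
apply: contrapT => /not_orP[/nonfinite_locusPn/choice[y yP] /VAPn[f Xf Pf]].
have /(spec_notM (P := pull_back P)) : ~ pull_back P (\prod_i y i).
  by apply: spec_not_prod => i; apply: (yP i).2.
move=> /(_ _ Pf); apply; apply: hP; exists (y, f) => //; split=> // i.
exact: (yP i).1.
Qed.

(** Cayley-Hamilton for x_i gives an element of I in k[y, x_i] whose leading coefficient is a
    product of powers of a, so the prime does not contain J_i. *)
Lemma finite_flat_over_sub (U : set (Spec (ringA I))) :
  finite_flat_over (mapAB I) U -> U `<=` ~` nonfinite_locus I.
Proof.
move=> ffU P /ffU[a [aP _ fin _]]; apply/nonfinite_locusPn => i.
move: aP fin; elim/quotW: a => a aP fin.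
have [q [C [D [E IC]]]] := integral_of_finite 'X_(rshift m i) fin.
exists (a ^+ E * (a ^+ D) ^+ q); split.
  exists (a ^+ E *: (char_poly C \Po (a ^+ D *: 'X))).
    by rewrite /= horner_char_poly.
  rewrite lead_coef_char_poly // -[_ != _]/(~~ (_ == _)); apply/eqP => aD0.
  have := spec_notX (P := pull_back P) (l := D) aP; rewrite aD0; apply.
  exact: ideal0.
by apply: spec_notM; [|apply: spec_notX]; apply: spec_notX.
Qed.

Section PurePowers.
Variables (Tx : rel 'X_{1..n}) (Ty : rel 'X_{1..m}) (G : seq {mpoly k[m + n]}).
Hypotheses (ordx : monomial_order Tx) (ordy : monomial_order Ty).
Hypothesis GB : groebner_basis (block_order_xy Tx Ty) I G.

Definition lc_x (g : {mpoly k[m + n]}) : Y := (poly_in_x g)@_(lm Tx (poly_in_x g)).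

(** In particular a point outside W can exist only if no P_i is empty. *)
Lemma finite_pure_power P : ~ nonfinite_locus I P ->
  exists g : 'I_n -> {mpoly k[m + n]},
    forall i, g i \in pure_power_basis Tx G i /\ ~ pull_back P (lc_x (g i)).
Proof.
move=> /nonfinite_locusPn nW.
suff /choice[g gP] : forall i, exists g,
    g \in pure_power_basis Tx G i /\ ~ pull_back P (lc_x g) by exists g.
move=> i; have [y [Jy Py]] := nW i.
have [|h|g gP Pg] := groebner_pure_power (P := pull_back P) (i := i) ordx ordy GB.
- by move=> a; apply: sub_pull_back.
- by apply: Py; apply: h.
- by exists g.
Qed.

Variables (r : nat) (mon : r.-tuple 'X_{1..n}).
Hypothesis mon_box : forall al : 'X_{1..n},
  al \in mon <-> forall i : 'I_n, (al i <= max_power Tx G i - 1)%N.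

Lemma generated_of_pure_power (g : 'I_n -> {mpoly k[m + n]}) (a c : Y) f :
  (forall i, g i \in pure_power_basis Tx G i) -> a = c * \prod_i lc_x (g i) ->
  generated (incl_y k m n) I (fun j => incl_x m 'X_[tnth mon j]) a f.
Proof.
move=> gP aE; apply: (monomials_generate ordx (t := max_power Tx G)) => [al lt_al|i].
  (* The strict bound forces t_i > 0, so the truncated subtraction t_i - 1 is a true one. *)
  by apply/mon_box => i; rewrite subn1 -ltnS (ltn_predK (lt_al i)).
have := gP i; rewrite mem_filter => /andP[/andP[gi0 /eqP giE]].
rewrite /basis_x mem_filter => /andP[_ giG].
exists (g i), (lm Tx (poly_in_x (g i)) i); split => //; first exact: GB.1.
  exact: (leq_bigmax_seq (P := predT) (F := fun g => lm Tx (poly_in_x g) i)).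
rewrite -giE aE (bigD1 i) //= [lc_x _ * _]mulrC mulrA.
by eexists.
Qed.

Variables (Txt : rel 'X_{1..n + 1}) (Tu : rel 'X_{1..r}) (Ty' : rel 'X_{1..m}).
Variables (H : seq {mpoly k[m + n + (1 + r)]}) (s : nat) (N : 'M[Y]_(r, s)).
Hypotheses (ordxt : monomial_order Txt) (ordu : monomial_order Tu).
Hypothesis ordy' : monomial_order Ty'.
Hypothesis GBL : groebner_basis (block_order_xtuy Txt Tu Ty') (ideal_L I mon) H.
Hypothesis homH : forall h, h \in H -> homogeneous_in (@is_var_tu m n r) h.
Hypothesis presN : presentation_matrix H N.

(** The size of the minors in F_(i-1). For i = 0 it is 1 + r, and there are no such minors, so
    F_(-1) = J. *)
Lemma absz_succ (i : nat) : (i <= r)%N -> `|r%:Z - (i%:Z - 1)%R|%N = (1 + (r - i))%N.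
Proof. by move=> ir; rewrite opprB addrCA subzn // -PoszD absz_nat. Qed.

Lemma absz_sub (i : nat) : (i <= r)%N -> `|r%:Z - i%:Z|%N = (r - i)%N.
Proof. by move=> ir; rewrite subzn // absz_nat. Qed.

(** Some h outside P lies in (J : F_(i-1)) and in F_i. The second membership gives a minor D of size
    q = r - i outside P, the first makes h kill the (q + 1)-minors modulo J; where h and D are
    invertible, N is therefore regular. *)
Lemma flat_locus_sub P : ~ nonfinite_locus I P -> ~ VA I (flatness_ideal I N) P ->
  exists a : ringA I, [/\ basic_open a P,
    basic_open a `<=` ~` (nonfinite_locus I `|` VA I (flatness_ideal I N)),
    finite_module (restr (loc_map (mapAB I) a)) &
    flat_module (restr (loc_map (mapAB I) a))].
Proof.
move=> nW nF; have [g gP] := finite_pure_power nW.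
have /nonfinite_locusPn/choice[y yP] := nW.
have [i [ir [h [[hcolon hF] Ph]]]] : exists i : nat, (i <= r)%N /\ exists h,
    (colon J (minors_ideal I N (i%:Z - 1)) `&` minors_ideal I N i%:Z) h /\
    ~ pull_back P h.
  apply: contrapT => nex; apply: nF; apply/VAP => f Ff.
  apply: (Ff (pull_back P)) => x [i ir Fx]; apply: contrapT => Px; apply: nex.
  by exists i; split=> //; exists x.
have hFl : flatness_ideal I N h by apply: sub_ideal_span; exists i.
have [D minD PD] : exists2 D, minors N (r - i) D & ~ pull_back P D.
  apply: contrapT => nex; apply: Ph.
  apply: (hF (pull_back P)) => x [Jx|]; first exact: sub_pull_back.
  rewrite absz_sub // => minx; apply: contrapT => Px; apply: nex.
  by exists x.
(* The factors [y j] and [h] keep D(a) away from W and V(F); inverting the leading coefficients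
   makes the m_j generate, and inverting [h] and [D] makes N regular. *)
pose b := (\prod_j y j) * h * D; pose a := b * \prod_j lc_x (g j).
have PMb Q : ~ pull_back Q a ->
    [/\ forall j, ~ pull_back Q (y j) & ~ pull_back Q h].
  move=> nQ; split=> [j Qj|Qh]; apply: nQ; rewrite /a /b.
    by do 3!apply: ideal_mulr; rewrite (bigD1 j) //; apply: ideal_mulr.
  by do 2!apply: ideal_mulr; apply: idealM.
exists (quot_pi J a); have gen f := generated_of_pure_power f (fun j => (gP j).1) (erefl a).
have reg : exists (C : 'M[Y]_(s, r)) l,
    forall p t, J (a ^+ l * N p t - (N *m C *m N) p t).
  have [f [u [_ _ DE]]] := minD.
  have K0 : J (h * 0) by rewrite mulr0; apply: ideal0.
  have KD v w : J (h * v) -> J (h * w) -> J (h * (v + w)).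
    by rewrite mulrDr; apply: idealD.
  have KM v w : J (h * w) -> J (h * (v * w)) by rewrite mulrCA; apply: idealM.
  (* Applied to the ideal (J : h), which contains the (1 + q)-minors. *)
  have [|C CP] := @regular_of_minors _ _ _ _ N (Ideal K0 KD KM) f u.
    move=> d mind; apply: hcolon; apply: sub_ideal_span; right.
    by rewrite absz_succ.
  (* Chosen so that c h D^2 = a^2. *)
  pose c := ((\prod_j y j) * \prod_j lc_x (g j)) ^+ 2 * h.
  exists (c * h *: C), 2 => p t.
  have := idealM (i := J) c (CP p t); congr (ideal_fun J).
  rewrite -scalemxAr -scalemxAl [X in _ = _ - X]mxE -DE mulrBr mulrBr !mulrA.
  congr (_ * _ - _); rewrite /c /a /b !exprMn; ring.
have [C [l CP]] := reg.
have [fin flat] := finite_flat_of_regular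
  (syzygy ordxt ordu ordy' GBL homH presN) (presentation_col GBL presN) gen CP.
split=> //.
- apply: (spec_notM (P := pull_back P)); last by apply: spec_not_prod => j; apply: (gP j).2.
  apply: spec_notM => //; apply: spec_notM => //.
  by apply: spec_not_prod => j; apply: (yP j).2.
- move=> Q /PMb[Qy Qh] [|/VAP/(_ _ hFl)//].
  by apply/nonfinite_locusPn => j; exists (y j); split=> //; apply: (yP j).1.
Qed.

(** Let q be the largest size of a minor D outside P, and b outside P an element that kills the (q +
    1)-minors modulo J, from [minors_of_regular]. Then b D is outside P and lies in the summand of F
    of index r - q. *)
Lemma flat_locus_sup (U : set (Spec (ringA I))) P : finite_flat_over (mapAB I) U ->
  U P -> ~ VA I (flatness_ideal I N) P.
Proof.
move=> ffU UP /VAP VP.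
have [g gP] := finite_pure_power (finite_flat_over_sub ffU UP).
have [a [aP _ fin flat]] := ffU P UP.
move: aP fin flat; elim/quotW: a => a aP fin flat.
have Pb : ~ pull_back P (\prod_i lc_x (g i)).
  by apply: spec_not_prod => i; apply: (gP i).2.
have gen f := generated_of_pure_power f (fun j => (gP j).1) (esym (mul1r _)).
have [C [delta [Pdelta reg]]] := regular_of_flat
  (syzygy ordxt ordu ordy' GBL homH presN) (presentation_col GBL presN)
  (P := pull_back P) aP Pb gen fin flat.
have ex_minor : exists q, `[< exists2 D, minors N q D & ~ pull_back P D >].
  (* The empty minor 1 lies outside every prime, so a largest size exists. *)
  exists 0%N; apply/asboolP; exists 1; last exact: spec_proper.
  have f0 (T : Type) : 'I_0 -> T by case.
  by exists (f0 _), (f0 _); split; [case | case | rewrite det_mx00].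
have bound q : `[< exists2 D, minors N q D & ~ pull_back P D >] -> (q <= r)%N.
  move=> /asboolP[D [f [u [homf _ _]]] _].
  have injf : injective f.
    move=> x z fxz; apply: contrapT => /eqP; rewrite neq_ltn => /orP[]/homf;
      by rewrite fxz ltnn.
  by have := leq_card f injf; rewrite !card_ord.
case: (ex_maxnP ex_minor bound) => q /asboolP[D minD PD] maxq.
have qr : (q <= r)%N by apply: bound; apply/asboolP; exists D.
have [f [u [_ _ DE]]] := minD.
have [|||b Pb' bmin] := minors_of_regular (P := pull_back P) (f := f) (g := u)
  _ Pdelta _ _ reg.
- by move=> x; apply: sub_pull_back.
- by rewrite -DE.
- move=> d mind; apply: contrapT => Pd.
  have /maxq : `[< exists2 D, minors N (1 + q) D & ~ pull_back P D >].
    by apply/asboolP; exists d.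
  by rewrite ltnn.
have : ~ pull_back P (b * D) by apply: spec_notM.
apply; apply: VP; apply: sub_ideal_span; exists (r - q)%N; first exact: leq_subr.
split.
  (* The ideal (J : b D) contains both J and the (q + 1)-minors, hence F_(r-q-1). *)
  have K0 : J (b * D * 0) by rewrite mulr0; apply: ideal0.
  have KD v w : J (b * D * v) -> J (b * D * w) -> J (b * D * (v + w)).
    by rewrite mulrDr; apply: idealD.
  have KM v w : J (b * D * w) -> J (b * D * (v * w)) by rewrite mulrCA; apply: idealM.
  move=> x Fx; apply: (Fx (Ideal K0 KD KM)) => z [Jz|]; first exact: (idealM (i := J)).
  rewrite absz_succ ?leq_subr // subKn // => /bmin Jbz.
  by rewrite /= mulrAC mulrC; apply: (idealM (i := J)).
apply: idealM; apply: sub_ideal_span; right.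
by rewrite absz_sub ?leq_subr // subKn.
Qed.

End PurePowers.
End Locus.

Theorem theorem5p6 (k : fieldType) (m n : nat) (I : ideal {mpoly k[m + n]})
    (Tx : rel 'X_{1..n}) (Ty : rel 'X_{1..m}) (G : seq {mpoly k[m + n]}) :
  monomial_order Tx -> monomial_order Ty ->
  groebner_basis (block_order_xy Tx Ty) I G ->
  (* some P_i is empty: F is undefined and V(F) is read as empty *)
  ((exists i : 'I_n, pure_power_basis Tx G i = [::]) ->
    is_largest_open (finite_flat_over (mapAB I))
      (~` (nonfinite_locus I `|` set0))) /\
  ((forall i : 'I_n, pure_power_basis Tx G i <> [::]) ->
    forall (r : nat) (mon : r.-tuple 'X_{1..n}),
    uniq mon ->
    (forall a : 'X_{1..n},
      a \in mon <-> forall i : 'I_n, (a i <= max_power Tx G i - 1)%N) ->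
    forall (Txt : rel 'X_{1..n + 1}) (Tu : rel 'X_{1..r}) (Ty' : rel 'X_{1..m})
      (H : seq {mpoly k[m + n + (1 + r)]}) (s : nat)
      (N : 'M[{mpoly k[m]}]_(r, s)),
    monomial_order Txt -> monomial_order Tu -> degree_compatible Tu ->
    monomial_order Ty' ->
    groebner_basis (block_order_xtuy Txt Tu Ty') (ideal_L I mon) H ->
    (forall h, h \in H -> homogeneous_in (@is_var_tu m n r) h) ->
    presentation_matrix H N ->
    is_largest_open (finite_flat_over (mapAB I))
      (~` (nonfinite_locus I `|` VA I (flatness_ideal I N)))).
Proof.
move=> ordx ordy GB; split=> [[i Pi0]|_ r mon _ mon_box Txt Tu Ty' H s N].
  (* An empty P_i leaves no point outside W, so the open set in question is empty. *)
  have WT P : nonfinite_locus I P.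
    apply: contrapT => /(finite_pure_power ordx ordy GB)[g /(_ i)[]].
    by rewrite Pi0.
  split=> [|P []|U _ ffU P UP]; last by have /(_ (WT P)) := finite_flat_over_sub ffU UP.
    (* The zero locus of the empty set is the whole spectrum. *)
    exists set0; apply/predeqP => P; split=> [[]|[]] //; left; exact: WT.
  by left; apply: WT.
move=> ordxt ordu _ ordy' GBL homH presN; split=> [|P /not_orP[nW nF]|U _ ffU P UP].
- exact: locus_complement_open.
- exact: (flat_locus_sub ordx ordy GB mon_box ordxt ordu ordy' GBL homH presN).
- case; first exact: (finite_flat_over_sub ffU UP).
  exact: (flat_locus_sup ordx ordy GB mon_box ordxt ordu ordy' GBL homH presN ffU UP).
Qed.
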